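(* Let $P$ be a simple weight $\mathcal D_n$-module and $V$ be a simple weight $\mathfrak{gl}(n)$-module with finite weight multiplicities. Then the $\mathcal W_n$-module $T(P,V)$ has finite weight multiplicities if and only if $(\Delta^I_P\sqcup\Delta^-_P)\subset(\Delta^F_V\sqcup\Delta^-_V)$.
   Context: Ground field $\mathbb C$. $\mathcal O_n=\mathbb C[x_1,\dots,x_n]$; $\mathcal D_n$ is the Weyl algebra of polynomial differential operators on $\mathcal O_n$; $\mathcal W_n=\mathrm{Der}(\mathcal O_n)$. A weight $\mathcal W_n$-module (resp. weight $\mathcal D_n$-module) is one which is the direct sum of its simultaneous eigenspaces (weight spaces) for $x_1\partial_1,\dots,x_n\partial_n$; a weight $\mathfrak{gl}(n)$-module is the direct sum of its weight spaces for the diagonal matrices $E_{ii}$ (identified with $x_i\partial_i$). Finite weight multiplicities means that all weight spaces are finite-dimensional. For a $\mathcal D_n$-module $P$ and a $\mathfrak{gl}(n)$-module $V$, the tensor module $T(P,V)=P\otimes_{\mathbb C}V$ has $\mathcal W_n$-action $x^\alpha\partial_j\cdot(f\otimes v)=(x^\alpha\partial_jf)\otimes v+\sum_{i=1}^n\partial_i(x^\alpha)f\otimes E_{ij}v$. Shadows: let $\Delta(\mathfrak{gl}(n))=\{\varepsilon_i-\varepsilon_j\mid i\ne j\}$. For a simple weight $\mathfrak{gl}(n)$-module $V$ with finite weight multiplicities, every root vector $X_\alpha$ acts either locally nilpotently or injectively, and $\Delta(\mathfrak{gl}(n))=\Delta^F_V\sqcup\Delta^I_V\sqcup\Delta^+_V\sqcup\Delta^-_V$,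 where $\alpha\in\Delta_V^F$ if $X_\alpha,X_{-\alpha}$ both act locally nilpotently; $\alpha\in\Delta_V^I$ if both act injectively; $\alpha\in\Delta_V^+$ if $X_\alpha$ acts locally nilpotently and $X_{-\alpha}$ injectively; and $\Delta_V^-=-\Delta_V^+$. For a simple weight $\mathcal D_n$-module $P$, each $x_i$ and each $\partial_i$ acts either injectively or locally nilpotently; $I^+(P)$ is the set of $i$ such that $\partial_i$ is locally nilpotent and $x_i$ injective, $I^-(P)$ the set of $i$ such that $x_i$ is locally nilpotent and $\partial_i$ injective, $I^0(P)$ the set of $i$ such that both are injective (these sets partition $\{1,\dots,n\}$). Then $\Delta^I_P=\{\varepsilon_i-\varepsilon_j\mid i\neq j\in I^0(P)\}$, $\Delta^F_P=\{\varepsilon_i-\varepsilon_j\mid i\ne j,\ i,j\in I^+(P)\text{ or }i,j\in I^-(P)\}$, $\Delta^-_P=\{\varepsilon_i-\varepsilon_j\mid i\in I^+(P),j\notin I^+(P)\text{ or }i\notin I^-(P),j\in I^-(P)\}$, $\Delta^+_P=-\Delta^-_P$. *)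

(* Defs.v *)
From HB Require Import structures.
From mathcomp Require Import all_boot all_order all_algebra.
From mathcomp Require Import generic_quotient ring_quotient.
From mathcomp Require Import complex.
From mathcomp Require Import boolp classical_sets reals.
From mathcomp Require Import mpoly freeg ring.

Set Implicit Arguments.
Unset Strict Implicit.
Unset Printing Implicit Defensive.

Import GRing.Theory.
Local Open Scope ring_scope.

Lemma mderivX_ord (F : fieldType) n (i j : 'I_n) :
  mderiv j ('X_i : {mpoly F[n]}) = (i == j)%:R.
Proof.
rewrite mderivX mnm1E; case: eqP => [->|_]; last by rewrite scale0r.
have -> : (U_(j) - U_(j) = 0 :> 'X_{1..n})%MM.
  by apply/mnmP=> k; rewrite mnmBE mnm0E subnn.
by rewrite scale1r mpolyX0.
Qed.

Section Endo.
Variables (F : fieldType) (n : nat).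
Local Notation O := {mpoly F[n]}.

Record endo := Endo { endo_fun :> O -> O; endo_linear : linear endo_fun }.

HB.instance Definition _ := gen_eqMixin endo.
HB.instance Definition _ := gen_choiceMixin endo.
HB.instance Definition _ (u : endo) :=
  GRing.isLinear.Build F O O _ (endo_fun u) (@endo_linear u).

Lemma endoP (u v : endo) : u =1 v -> u = v.
Proof.
case: u v => [f fl] [g gl] /= /funext fg; rewrite {f}fg in fl *.
by congr Endo; exact: Prop_irrelevance.
Qed.

Program Definition endo0 := @Endo (fun=> 0) _.
Next Obligation. by move=> a f g; rewrite scaler0 addr0. Qed.
Program Definition endoN (u : endo) := @Endo (fun f => - u f) _.
Next Obligation. by move=> a f g; rewrite linearP opprD scalerN. Qed.
Program Definition endoD (u v : endo) := @Endo (fun f => u f + v f) _.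
Next Obligation. by move=> a f g; rewrite !linearP scalerDr addrACA. Qed.
Program Definition endo1 := @Endo id _.
Next Obligation. by []. Qed.
Program Definition endoM (u v : endo) := @Endo (fun f => u (v f)) _.
Next Obligation. by move=> a f g; rewrite !linearP. Qed.
Program Definition endoZ (c : F) (u : endo) := @Endo (fun f => c *: u f) _.
Next Obligation.
by move=> a f g; rewrite linearP scalerDr !scalerA mulrC.
Qed.

Fact endo_addA : associative endoD.
Proof. by move=> u v w; apply: endoP => f /=; rewrite addrA. Qed.
Fact endo_addC : commutative endoD.
Proof. by move=> u v; apply: endoP => f /=; rewrite addrC. Qed.
Fact endo_add0 : left_id endo0 endoD.
Proof. by move=> u; apply: endoP => f /=; rewrite add0r. Qed.
Fact endo_addN : left_inverse endo0 endoN endoD.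
Proof. by move=> u; apply: endoP => f /=; rewrite addNr. Qed.

HB.instance Definition _ :=
  GRing.isZmodule.Build endo endo_addA endo_addC endo_add0 endo_addN.

Fact endo_mulA : associative endoM.
Proof. by move=> u v w; apply: endoP. Qed.
Fact endo_mul1 : left_id endo1 endoM.
Proof. by move=> u; apply: endoP. Qed.
Fact endo_mulr1 : right_id endo1 endoM.
Proof. by move=> u; apply: endoP. Qed.
Fact endo_mulDl : left_distributive endoM +%R.
Proof. by move=> u v w; apply: endoP. Qed.
Fact endo_mulDr : right_distributive endoM +%R.
Proof. by move=> u v w; apply: endoP => f /=; rewrite linearD. Qed.
Fact endo_1neq0 : endo1 != 0 :> endo.
Proof.
apply/eqP => /(congr1 (fun u : endo => u 1)) /= /eqP.
by rewrite oner_eq0.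
Qed.

HB.instance Definition _ := GRing.Zmodule_isNzRing.Build endo
  endo_mulA endo_mul1 endo_mulr1 endo_mulDl endo_mulDr endo_1neq0.

Fact endo_scaleA a b u : endoZ a (endoZ b u) = endoZ (a * b) u.
Proof. by apply: endoP => f /=; rewrite scalerA. Qed.
Fact endo_scale1 : left_id 1 endoZ.
Proof. by move=> u; apply: endoP => f /=; rewrite scale1r. Qed.
Fact endo_scaleDr : right_distributive endoZ +%R.
Proof. by move=> c u v; apply: endoP => f /=; rewrite scalerDr. Qed.
Fact endo_scaleDl u : {morph endoZ^~ u : a b / a + b}.
Proof. by move=> a b; apply: endoP => f /=; rewrite scalerDl. Qed.

HB.instance Definition _ := GRing.Zmodule_isLmodule.Build F endo
  endo_scaleA endo_scale1 endo_scaleDr endo_scaleDl.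

Fact endo_scaleAl (a : F) (u v : endo) : a *: (u * v) = (a *: u) * v.
Proof. exact: endoP. Qed.
HB.instance Definition _ := GRing.Lmodule_isLalgebra.Build F endo endo_scaleAl.
Fact endo_scaleAr (a : F) (u v : endo) : a *: (u * v) = u * (a *: v).
Proof. by apply: endoP => f /=; rewrite linearZ. Qed.
HB.instance Definition _ := GRing.Lalgebra_isAlgebra.Build F endo endo_scaleAr.

Lemma endoDE (u v : endo) f : (u + v) f = u f + v f. Proof. by []. Qed.
Lemma endoBE (u v : endo) f : (u - v) f = u f - v f. Proof. by []. Qed.
Lemma endoZE c (u : endo) f : (c *: u) f = c *: u f. Proof. by []. Qed.
Lemma endoME (u v : endo) f : (u * v) f = u (v f). Proof. by []. Qed.
Lemma endo_sumE I (r : seq I) (Q : pred I) (u : I -> endo) f :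
  (\sum_(i <- r | Q i) u i) f = \sum_(i <- r | Q i) u i f.
Proof. by elim/big_rec2: _ => //= i y1 y2 _ <-. Qed.

Program Definition mul_op (f : O) := @Endo (fun g => f * g) _.
Next Obligation. by move=> a g h; rewrite mulrDr scalerAr. Qed.
Program Definition deriv_op (i : 'I_n) := @Endo (mderiv i) _.
Next Obligation. exact: mderiv_is_linear. Qed.

End Endo.

Section Weyl.
Variables (F : fieldType) (n : nat).
Local Notation O := {mpoly F[n]}.
Local Notation endo := (endo F n).

(* The subalgebra of endomorphisms generated by the x_i and the partial_i: in
   characteristic 0 these are all the polynomial differential operators. *)
Inductive diff_op : endo -> Prop :=
| DiffX i : diff_op (mul_op 'X_i)
| DiffD i : diff_op (deriv_op F i)
| Diff1 : diff_op 1
| DiffP c u v : diff_op u -> diff_op v -> diff_op (c *: u + v)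
| DiffM u v : diff_op u -> diff_op v -> diff_op (u * v).

Definition weyl_pred : {pred endo} := fun u => `[< diff_op u >].

Lemma weyl_predP u : reflect (diff_op u) (u \in weyl_pred).
Proof. exact: asboolP. Qed.

Lemma diff_op0 : diff_op 0.
Proof.
by rewrite -(addNr 1) -scaleN1r; apply: DiffP; exact: Diff1.
Qed.

Fact weyl_closed : GRing.subsemialg_closed weyl_pred.
Proof.
split.
- by apply/weyl_predP; exact: Diff1.
- split; first by apply/weyl_predP; exact: diff_op0.
  by move=> u v /weyl_predP du /weyl_predP dv; apply/weyl_predP;
    rewrite -[u]scale1r; exact: DiffP.
- move=> c u /weyl_predP du; apply/weyl_predP.
  by rewrite -[_ *: _]addr0; exact: DiffP du diff_op0.
- by move=> u v /weyl_predP du /weyl_predP dv; apply/weyl_predP; exact: DiffM.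
Qed.
HB.instance Definition _ := GRing.isSubalgClosed.Build F endo weyl_pred weyl_closed.

Record weyl := Weyl { weyl_op : endo; weyl_opP : weyl_op \in weyl_pred }.

HB.instance Definition _ := [isSub for weyl_op].
HB.instance Definition _ := [Choice of weyl by <:].
HB.instance Definition _ := [SubChoice_isSubAlgebra of weyl by <:].

Lemma weylP (u v : weyl) : weyl_op u = weyl_op v -> u = v.
Proof. exact: val_inj. Qed.

Fact mul_op_weyl (f : O) : mul_op f \in weyl_pred.
Proof.
have mulB c (g h : O) : mul_op (c *: g + h) = c *: mul_op g + mul_op h.
  by apply: endoP => k; rewrite endoDE endoZE /= mulrDl scalerAl.
have mulM (g h : O) : mul_op (g * h) = mul_op g * mul_op h.
  by apply: endoP => k; rewrite endoME /= mulrA.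
have mul1 : mul_op (1 : O) = 1 by apply: endoP => k /=; rewrite mul1r.
have mulX m : diff_op (mul_op ('X_[m] : O)).
  rewrite mpolyXE_id; elim/big_ind: _ => [|g h|i _].
  - by rewrite mul1; exact: Diff1.
  - by rewrite mulM; exact: DiffM.
  elim: (m i) => [|k ihk]; first by rewrite expr0 mul1; exact: Diff1.
  by rewrite exprS mulM; apply: DiffM => //; exact: DiffX.
apply/weyl_predP; elim/mpolyind: f => [|c m g _ _ dg].
  suff -> : mul_op (0 : O) = 0 by exact: diff_op0.
  by apply: endoP => k /=; rewrite mul0r.
by rewrite mulB; exact: DiffP.
Qed.

Fact deriv_op_weyl i : deriv_op F i \in weyl_pred.
Proof. by apply/weyl_predP; exact: DiffD. Qed.

Definition wpoly (f : O) : weyl := Weyl (mul_op_weyl f).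
Definition wder (i : 'I_n) : weyl := Weyl (deriv_op_weyl i).

End Weyl.

Section Witt.
Variables (F : fieldType) (n : nat).
Local Notation O := {mpoly F[n]}.
Local Notation endo := (endo F n).

Definition der_pred : {pred endo} :=
  fun u => `[< forall f g : O, u (f * g) = u f * g + f * u g >].

Lemma der_predP (u : endo) :
  reflect (forall f g : O, u (f * g) = u f * g + f * u g) (u \in der_pred).
Proof. exact: asboolP. Qed.

Fact der_closed : GRing.subsemimod_closed der_pred.
Proof.
split; first split.
- by apply/der_predP => f g /=; rewrite mul0r mulr0 addr0.
- move=> u v /der_predP du /der_predP dv; apply/der_predP => f g.
  by rewrite !endoDE du dv mulrDl mulrDr addrACA.
- move=> c u /der_predP du; apply/der_predP => f g.
  by rewrite !endoZE du scalerDr scalerAl scalerAr.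
Qed.
HB.instance Definition _ := GRing.isSubmodClosed.Build F endo der_pred der_closed.

Record witt := Witt { witt_op :> endo; witt_opP : witt_op \in der_pred }.

HB.instance Definition _ := [isSub for witt_op].
HB.instance Definition _ := [Choice of witt by <:].
HB.instance Definition _ := [SubChoice_isSubLmodule of witt by <:].

Lemma wittM (D : witt) (f g : O) : D (f * g) = D f * g + f * D g.
Proof. by have /der_predP := witt_opP D; apply. Qed.

Lemma witt_opP' c (D E : witt) : witt_op (c *: D + E) = c *: witt_op D + witt_op E.
Proof. exact: (linearP (\val : witt -> endo)). Qed.
Lemma witt_opB (D E : witt) : witt_op (D - E) = witt_op D - witt_op E.
Proof. exact: (raddfB (\val : witt -> endo)). Qed.
Lemma witt_op_sum I (r : seq I) (Q : pred I) (D : I -> witt) :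
  witt_op (\sum_(i <- r | Q i) D i) = \sum_(i <- r | Q i) witt_op (D i).
Proof. exact: (raddf_sum (\val : witt -> endo)). Qed.

Fact witt_br_subproof (D E : witt) :
  witt_op D * witt_op E - witt_op E * witt_op D \in der_pred.
Proof.
apply/der_predP => f g.
rewrite !endoBE !endoME !wittM !linearD /= !wittM mulrBl mulrBr.
by ring.
Qed.
Definition witt_br (D E : witt) : witt := Witt (witt_br_subproof D E).

Fact wvf_subproof (f : O) (j : 'I_n) :
  mul_op f * deriv_op F j \in der_pred.
Proof.
apply/der_predP => g h; rewrite !endoME /= mderivM; ring.
Qed.
(* The vector field f partial_j. *)
Definition wvf (f : O) (j : 'I_n) : witt := Witt (wvf_subproof f j).

Lemma witt1 (D : witt) : D 1 = 0.
Proof.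
have := wittM D 1 1; rewrite !mulr1 mul1r => /eqP.
by rewrite -subr_eq0 opprD addrA subrr sub0r oppr_eq0 => /eqP.
Qed.

Lemma witt_eq0 (D : witt) : (forall i, D 'X_i = 0) -> witt_op D = 0.
Proof.
move=> D0; apply: endoP => f /=.
elim/mpolyind: f => [|c m g _ _ dg]; first by rewrite linear0.
rewrite linearP /= dg addr0 mpolyXE_id.
suff -> : D (\prod_(i < n) 'X_i ^+ m i) = 0 by rewrite scaler0.
elim/big_ind: _ => [|f h df dh|i _]; first exact: witt1.
  by rewrite wittM df dh mul0r mulr0 addr0.
elim: (m i) => [|k ihk]; first by rewrite expr0 witt1.
by rewrite exprS wittM D0 ihk mul0r mulr0 addr0.
Qed.

Lemma witt_sum (D : witt) : D = \sum_(j < n) wvf (D 'X_j) j.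
Proof.
apply/eqP; rewrite -subr_eq0; apply/eqP; apply: val_inj.
transitivity (0 : endo); last by rewrite raddf0.
apply: witt_eq0 => i; rewrite witt_opB endoBE witt_op_sum endo_sumE.
apply/eqP; rewrite subr_eq0; apply/eqP.
rewrite (bigD1 i) //= mderivX_ord eqxx mulr1 big1 ?addr0 // => j ji.
by rewrite mderivX_ord eq_sym (negPf ji) mulr0.
Qed.
End Witt.

Section Tensor.
Variables (F : fieldType) (P V : lmodType F).
Local Notation free := {freeg (P * V)%type / F}.

Definition fgen (p : P) (v : V) : free := << (p, v) >>.

(* The subspace of the free vector space on P * V spanned by the bilinearity
   relations; the tensor product is the quotient by it. *)
Inductive tens_rel : free -> Prop :=
| TensDl p q v : tens_rel (fgen (p + q) v - fgen p v - fgen q v)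
| TensDr p v w : tens_rel (fgen p (v + w) - fgen p v - fgen p w)
| TensZl c p v : tens_rel (fgen (c *: p) v - c *: fgen p v)
| TensZr c p v : tens_rel (fgen p (c *: v) - c *: fgen p v)
| Tens0 : tens_rel 0
| TensP c x y : tens_rel x -> tens_rel y -> tens_rel (c *: x + y).

Definition tens_pred : {pred free} := fun x => `[< tens_rel x >].

Lemma tens_predP x : reflect (tens_rel x) (x \in tens_pred).
Proof. exact: asboolP. Qed.

Fact tens_closed : GRing.subsemimod_closed tens_pred.
Proof.
split; first split.
- by apply/tens_predP; exact: Tens0.
- move=> x y /tens_predP dx /tens_predP dy; apply/tens_predP.
  by rewrite -[x]scale1r; exact: TensP.
- move=> c x /tens_predP dx; apply/tens_predP.
  by rewrite -[_ *: _]addr0; exact: TensP dx Tens0.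
Qed.
HB.instance Definition _ := GRing.isSubmodClosed.Build F free tens_pred tens_closed.

Definition tensor : Type := {ideal_quot tens_pred}.
HB.instance Definition _ := GRing.Zmodule.on tensor.

Local Open Scope quotient_scope.

Definition tpi (x : free) : tensor := \pi_({ideal_quot tens_pred}) x.
Definition trepr (t : tensor) : free := repr (t : {ideal_quot tens_pred}).

Lemma tpi_eq x y : (tpi x = tpi y) <-> tens_rel (x - y).
Proof.
rewrite /tpi; split=> [/eqP|xy]; last apply/eqP.
  by rewrite -Quotient.idealrBE => /tens_predP.
by rewrite -Quotient.idealrBE; apply/tens_predP.
Qed.

Lemma tpiD x y : tpi (x + y) = tpi x + tpi y.
Proof. by rewrite /tpi; exact: Quotient.pi_add. Qed.

Definition tensor_scale (c : F) (t : tensor) : tensor :=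
  tpi (c *: trepr t).

Lemma tpi_repr (t : tensor) : tpi (trepr t) = t.
Proof. exact: reprK. Qed.

Lemma tensor_scale_pi c x : tensor_scale c (tpi x) = tpi (c *: x).
Proof.
apply/tpi_eq; rewrite -scalerBr -[_ *: _]addr0; apply: TensP; last exact: Tens0.
by apply/tpi_eq; rewrite tpi_repr.
Qed.

Fact tensor_scaleA a b t :
  tensor_scale a (tensor_scale b t) = tensor_scale (a * b) t.
Proof. by rewrite -[t]tpi_repr !tensor_scale_pi scalerA. Qed.
Fact tensor_scale1 : left_id 1 tensor_scale.
Proof. by move=> t; rewrite -[t]tpi_repr tensor_scale_pi scale1r. Qed.
Fact tensor_scaleDr : right_distributive tensor_scale +%R.
Proof.
move=> c t u; rewrite -[t]tpi_repr -[u]tpi_repr -tpiD !tensor_scale_pi.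
by rewrite scalerDr tpiD.
Qed.
Fact tensor_scaleDl t : {morph tensor_scale^~ t : a b / a + b}.
Proof.
by move=> a b; rewrite -[t]tpi_repr !tensor_scale_pi scalerDl tpiD.
Qed.
HB.instance Definition _ := GRing.Zmodule_isLmodule.Build F tensor
  tensor_scaleA tensor_scale1 tensor_scaleDr tensor_scaleDl.

Lemma tpiZ c x : tpi (c *: x) = c *: tpi x.
Proof. exact: esym (tensor_scale_pi c x). Qed.

Lemma tpi0 : tpi 0 = 0.
Proof. by apply: (addIr (tpi 0)); rewrite -tpiD !add0r. Qed.

Definition tens (p : P) (v : V) : tensor := tpi (fgen p v).

Lemma tens_linearl v : linear (tens^~ v).
Proof.
move=> c p q; rewrite -tpiZ -tpiD.
transitivity (tpi (fgen (c *: p) v + fgen q v)).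
  by apply/tpi_eq; rewrite opprD addrA; exact: TensDl.
rewrite !tpiD; congr (_ + _); apply/tpi_eq; exact: TensZl.
Qed.

Lemma tens_linearr p : linear (tens p).
Proof.
move=> c v w; rewrite -tpiZ -tpiD.
transitivity (tpi (fgen p (c *: v) + fgen p w)).
  by apply/tpi_eq; rewrite opprD addrA; exact: TensDr.
rewrite !tpiD; congr (_ + _); apply/tpi_eq; exact: TensZr.
Qed.

HB.instance Definition _ p := GRing.isLinear.Build F V tensor _ (tens p) (tens_linearr p).

Lemma tens_ind (Q : tensor -> Prop) :
  Q 0 -> (forall p v t, Q t -> Q (tens p v + t)) -> forall t, Q t.
Proof.
move=> Q0 Q1 t; rewrite -[t]tpi_repr.
elim/freeg_ind_dom0: (trepr _) => [|c [p v] x _ _ Qx]; first by rewrite tpi0.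
rewrite tpiD; have -> : << c *g (p, v) >> = c *: fgen p v.
  by apply/eqP/freeg_eqP=> k; rewrite coeffZ !coeffU mul1r.
by rewrite tpiZ -/(tens p v) -linearZ; exact: Q1.
Qed.

End Tensor.

Section TensorLift.
Variables (F : fieldType) (P V U : lmodType F) (f : P -> V -> U).

Definition tlift (t : tensor P V) : U :=
  fglift (fun k => f k.1 k.2) (trepr t).

Hypothesis fl : forall v, linear (f^~ v).
Hypothesis fr : forall p, linear (f p).

Let g : {freeg (P * V)%type / F} -> U := fglift (fun k => f k.1 k.2).

Let gB x y : g (x - y) = g x - g y.
Proof. exact: lift_is_additive. Qed.

Let g0 : g 0 = 0.
Proof. by rewrite -[X in g X](subrr 0) gB subrr. Qed.

Let gD x y : g (x + y) = g x + g y.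
Proof. by rewrite -[y in LHS]opprK gB -[- y]add0r gB g0 sub0r opprK. Qed.

Let gZ c x : g (c *: x) = c *: g x.
Proof.
elim/freeg_ind_dom0: x => [|d k x _ _ ih]; first by rewrite scaler0 g0 scaler0.
rewrite scalerDr !gD ih scalerDr; congr (_ + _).
have -> : c *: << d *g k >> = << (c * d) *g k >>.
  by apply/eqP/freeg_eqP=> l; rewrite coeffZ !coeffU mulrA.
by rewrite /g !liftU scalerA.
Qed.

Let g_rel x : tens_rel x -> g x = 0.
Proof.
elim=> [p q v|p v w|c p v|c p v||c y z _ y0 _ z0].
- rewrite !gB /g !liftU !scale1r /=.
  by have := fl v 1 p q; rewrite !scale1r => ->; rewrite -addrA -opprD subrr.
- rewrite !gB /g !liftU !scale1r /=.
  by have := fr p 1 v w; rewrite !scale1r => ->; rewrite -addrA -opprD subrr.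
- rewrite gB gZ /g !liftU !scale1r /=.
  have f0 : f 0 v = 0 by have := fl v (-1) 0 0; rewrite /= scaler0 addr0 scaleN1r addNr.
  by have := fl v c p 0; rewrite /= !addr0 f0 addr0 => ->; rewrite subrr.
- rewrite gB gZ /g !liftU !scale1r /=.
  have f0 : f p 0 = 0 by have := fr p (-1) 0 0; rewrite /= scaler0 addr0 scaleN1r addNr.
  by have := fr p c v 0; rewrite !addr0 f0 addr0 => ->; rewrite subrr.
- exact: g0.
- by rewrite gD gZ y0 z0 scaler0 addr0.
Qed.

Let tlift_pi x : tlift (tpi x) = g x.
Proof.
apply/eqP; rewrite -subr_eq0 -gB; apply/eqP/g_rel/tpi_eq.
exact: tpi_repr.
Qed.

Lemma tliftE p v : tlift (tens p v) = f p v.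
Proof. by rewrite tlift_pi /g liftU scale1r. Qed.

Lemma tlift_linear : linear tlift.
Proof.
move=> c t u; rewrite -[t]tpi_repr -[u]tpi_repr -tpiZ -tpiD !tlift_pi.
by rewrite gD gZ.
Qed.

End TensorLift.

Section TensorTheory.
Variables (F : fieldType) (P V : lmodType F).
Implicit Types (p q : P) (v : V).
Lemma tensDl p q v : tens (p + q) v = tens p v + tens q v.
Proof. by have := tens_linearl v 1 p q; rewrite !scale1r. Qed.
Lemma tens0l v : tens (0 : P) v = 0.
Proof. by apply: (addIr (tens 0 v)); rewrite -tensDl !add0r. Qed.
Lemma tensBl p q v : tens (p - q) v = tens p v - tens q v.
Proof. by apply: (addIr (tens q v)); rewrite -tensDl !subrK. Qed.
Lemma tens_suml I (r : seq I) (Q : pred I) (f : I -> P) v :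
  tens (\sum_(i <- r | Q i) f i) v = \sum_(i <- r | Q i) tens (f i) v.
Proof.
by elim/big_rec2: _ => [|i y1 y2 _ <-]; [exact: tens0l | exact: tensDl].
Qed.
End TensorTheory.

Lemma sum_pair_delta (M : zmodType) n (G : 'I_n -> 'I_n -> 'I_n -> 'I_n -> M) :
  \sum_(x : 'I_n * 'I_n) \sum_(y : 'I_n * 'I_n)
     G x.1 x.2 y.1 y.2 *+ (y.2 == x.1)
  = \sum_(z : 'I_n * 'I_n) \sum_(k < n) G k z.2 z.1 k.
Proof.
transitivity (\sum_(k < n) \sum_(j < n) \sum_(i < n) G k j i k).
  rewrite [RHS]pair_bigA; apply: eq_bigr => x _.
  rewrite -(pair_bigA _ (fun i k => G x.1 x.2 i k *+ (k == x.1))) /=.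
  apply: eq_bigr => i _; rewrite (bigD1 x.1) //= eqxx mulr1n big1 ?addr0 // => k.
  by move/negPf->.
rewrite -(pair_bigA _ (fun i j => \sum_(k < n) G k j i k)) /=.
rewrite exchange_big /= [RHS]exchange_big /=; apply: eq_bigr => j _.
exact: exchange_big.
Qed.

Section Restrict.
Variables (F : fieldType) (A : algType F) (M : lmodType A).

(* [M] as a vector space over F, where c acts as c%:A. *)
Definition restrict : Type := M.
HB.instance Definition _ := GRing.Zmodule.on restrict.

Definition restrict_scale (c : F) (m : restrict) : restrict :=
  (c%:A : A) *: (m : M).

Fact restrict_scaleA a b m :
  restrict_scale a (restrict_scale b m) = restrict_scale (a * b) m.
Proof. by rewrite /restrict_scale scalerA mulr_algl scalerA. Qed.
Fact restrict_scale1 : left_id 1 restrict_scale.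
Proof. by move=> m; rewrite /restrict_scale !scale1r. Qed.
Fact restrict_scaleDr : right_distributive restrict_scale +%R.
Proof. by move=> c m p; rewrite /restrict_scale scalerDr. Qed.
Fact restrict_scaleDl m : {morph restrict_scale^~ m : a b / a + b}.
Proof. by move=> a b; rewrite /restrict_scale !scalerDl. Qed.
HB.instance Definition _ := GRing.Zmodule_isLmodule.Build F restrict
  restrict_scaleA restrict_scale1 restrict_scaleDr restrict_scaleDl.

Lemma restrictZ c (m : restrict) : c *: m = (c%:A : A) *: (m : M) :> M.
Proof. by []. Qed.

Definition ract (u : A) (m : restrict) : restrict := u *: (m : M).

Lemma ract_linear u : linear (ract u).
Proof.
move=> c m p; rewrite /ract scalerDr; congr (_ + _).
by rewrite !restrictZ !scalerA mulr_algl mulr_algr.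
Qed.
HB.instance Definition _ u :=
  GRing.isLinear.Build F restrict restrict _ (ract u) (ract_linear u).

Lemma ract_linearl m : linear (ract^~ m).
Proof.
move=> c u v; rewrite /ract scalerDl; congr (_ + _).
by rewrite restrictZ scalerA mulr_algl.
Qed.
Lemma ractB u v m : ract (u - v) m = ract u m - ract v m.
Proof. exact: (@scalerBl A M u v m). Qed.
Lemma ractD u v m : ract (u + v) m = ract u m + ract v m.
Proof. exact: (@scalerDl A M m u v). Qed.
Lemma ractM u v m : ract (u * v) m = ract u (ract v m).
Proof. by rewrite /ract scalerA. Qed.
Lemma ract_suml I (r : seq I) (Q : pred I) (f : I -> A) m :
  ract (\sum_(i <- r | Q i) f i) m = \sum_(i <- r | Q i) ract (f i) m.
Proof. exact: (@scaler_suml A M). Qed.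

End Restrict.

(* Modules over the Lie algebra with underlying space [g] and bracket [br]. Only
   commutator brackets are used below, so the Lie algebra axioms are not
   recorded. *)
Record lieModule (F : fieldType) (g : lmodType F) (br : g -> g -> g) :=
  LieModule {
    lie_sort :> lmodType F;
    lie_act : g -> lie_sort -> lie_sort;
    lie_act_linear : forall X, linear (lie_act X);
    lie_act_linearl : forall v, linear (lie_act^~ v);
    lie_act_br : forall X Y v,
      lie_act (br X Y) v = lie_act X (lie_act Y v) - lie_act Y (lie_act X v)
  }.

HB.instance Definition _ F g br (V : @lieModule F g br) X :=
  GRing.isLinear.Build F V V _ (@lie_act F g br V X) (lie_act_linear X).

Definition gl_br (F : fieldType) (n : nat) (A B : 'M[F]_n) : 'M[F]_n :=
  A *m B - B *m A.

Section TensorModule.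
Variables (F : fieldType) (n : nat).
Local Notation O := {mpoly F[n]}.
Local Notation E i j := (delta_mx i j : 'M[F]_n).

Fact witt_weyl_subproof (D : witt F n) : witt_op D \in @weyl_pred F n.
Proof.
rewrite (witt_sum D) witt_op_sum; apply: rpred_sum => j _.
by apply: rpredM; [exact: mul_op_weyl | exact: deriv_op_weyl].
Qed.
Definition witt_weyl (D : witt F n) : weyl F n := Weyl (witt_weyl_subproof D).

Lemma weyl_opL c (u v : weyl F n) : weyl_op (c *: u + v) = c *: weyl_op u + weyl_op v.
Proof. exact: (linearP (\val : weyl F n -> endo F n)). Qed.
Lemma weyl_opM (u v : weyl F n) : weyl_op (u * v) = weyl_op u * weyl_op v.
Proof. exact: (rmorphM (\val : weyl F n -> endo F n)). Qed.
Lemma weyl_opB (u v : weyl F n) : weyl_op (u - v) = weyl_op u - weyl_op v.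
Proof. exact: (raddfB (\val : weyl F n -> endo F n)). Qed.
Lemma weyl_opD (u v : weyl F n) : weyl_op (u + v) = weyl_op u + weyl_op v.
Proof. exact: (raddfD (\val : weyl F n -> endo F n)). Qed.

Lemma wpoly_linear : linear (@wpoly F n).
Proof.
move=> c f g; apply: weylP; rewrite weyl_opL; apply: endoP => h.
by rewrite endoDE endoZE /= mulrDl scalerAl.
Qed.
HB.instance Definition _ :=
  GRing.isLinear.Build F O (weyl F n) _ (@wpoly F n) wpoly_linear.

Lemma wpolyM (f g : O) : wpoly (f * g) = wpoly f * wpoly g.
Proof.
by apply: weylP; rewrite weyl_opM; apply: endoP => h; rewrite endoME /= mulrA.
Qed.

Lemma witt_weyl_linear : linear witt_weyl.
Proof. by move=> c D D'; apply: weylP; rewrite weyl_opL; exact: witt_opP'. Qed.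
HB.instance Definition _ :=
  GRing.isLinear.Build F (witt F n) (weyl F n) _ witt_weyl witt_weyl_linear.

Lemma witt_weyl_br D D' :
  witt_weyl (witt_br D D') = witt_weyl D * witt_weyl D' - witt_weyl D' * witt_weyl D.
Proof. by apply: weylP; rewrite weyl_opB !weyl_opM. Qed.

Lemma witt_weyl_poly D (f : O) :
  witt_weyl D * wpoly f = wpoly f * witt_weyl D + wpoly (D f).
Proof.
apply: weylP; rewrite weyl_opD !weyl_opM; apply: endoP => g.
by rewrite endoDE !endoME /= wittM addrC.
Qed.

Lemma wittE (D : witt F n) (f : O) : D f = \sum_(k < n) D 'X_k * mderiv k f.
Proof. by rewrite {1}(witt_sum D) witt_op_sum endo_sumE. Qed.

Definition jac (D : witt F n) (x : 'I_n * 'I_n) : O := mderiv x.1 (D 'X_x.2).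

Lemma jac_linear x : linear (jac^~ x).
Proof.
by move=> c D D'; rewrite /jac witt_opP' endoDE endoZE -linearP.
Qed.

Lemma mderiv_witt (D : witt F n) i (f : O) :
  mderiv i (D f) = D (mderiv i f) + \sum_(k < n) jac D (i, k) * mderiv k f.
Proof.
rewrite [D f]wittE raddf_sum /= [D (mderiv i f)]wittE -big_split /=.
by apply: eq_bigr => k _; rewrite mderivM mderiv_comm addrC.
Qed.

Lemma jac_br (D D' : witt F n) x :
  jac (witt_br D D') x = D (jac D' x) - D' (jac D x)
    + \sum_(k < n) (jac D (x.1, k) * jac D' (k, x.2)
                    - jac D' (x.1, k) * jac D (k, x.2)).
Proof.
have -> : jac (witt_br D D') x = mderiv x.1 (D (D' 'X_x.2) - D' (D 'X_x.2)) by [].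
rewrite mderivB [X in X - _]mderiv_witt [X in _ - X]mderiv_witt sumrB.
by rewrite opprD addrACA.
Qed.

Variables (P : lmodType (weyl F n)) (V : lieModule (@gl_br F n)).
Local Notation T := (tensor (restrict P) V).

(* A vector field D is the sum of the f_j partial_j with f_j = D x_j, so this is
   the action of x^a partial_j extended linearly; [tensor_module_vf] recovers the
   formula on x^a partial_j. *)
Definition tmod_fun (D : witt F n) (p : restrict P) (v : V) : T :=
  tens (ract (witt_weyl D) p) v
  + \sum_(i < n) \sum_(j < n)
      tens (ract (wpoly (mderiv i (D 'X_j))) p) (lie_act (E i j) v).

Definition tmod_act (D : witt F n) : T -> T := tlift (tmod_fun D).

Let tmod_funE D p v : tmod_fun D p v = tens (ract (witt_weyl D) p) v
  + \sum_x tens (ract (wpoly (jac D x)) p) (lie_act (E x.1 x.2) v).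
Proof. by rewrite /tmod_fun pair_big. Qed.

Lemma tmod_fun_linearl D v : linear (fun p => tmod_fun D p v).
Proof.
move=> c p q; rewrite !tmod_funE linearP tens_linearl scalerDr addrACA.
congr (_ + _); rewrite scaler_sumr -big_split /=; apply: eq_bigr => x _.
by rewrite linearP tens_linearl.
Qed.

Lemma tmod_fun_linearr D p : linear (tmod_fun D p).
Proof.
move=> c v w; rewrite !tmod_funE linearP scalerDr addrACA.
congr (_ + _); rewrite scaler_sumr -big_split /=; apply: eq_bigr => x _.
by rewrite !linearP.
Qed.

Lemma tmod_act_tens D p v : tmod_act D (tens p v) = tmod_fun D p v.
Proof.
exact: tliftE (tmod_fun_linearl D) (tmod_fun_linearr D) p v.
Qed.

Lemma tmod_act_linear D : linear (tmod_act D).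
Proof.
exact: tlift_linear (tmod_fun_linearl D) (tmod_fun_linearr D).
Qed.
HB.instance Definition _ D :=
  GRing.isLinear.Build F T T _ (tmod_act D) (tmod_act_linear D).

Lemma tmod_act_linearl t : linear (tmod_act^~ t).
Proof.
move=> c D D'; elim/tens_ind: t => [|p v t ih].
  by rewrite !linear0 ?scaler0 ?addr0.
rewrite !linearD /= ih !tmod_act_tens.
suff : tmod_fun (c *: D + D') p v = c *: tmod_fun D p v + tmod_fun D' p v.
  move: (tmod_fun (c *: D + D') p v) (tmod_fun D p v) (tmod_fun D' p v).
  by move=> a b d ->; rewrite addrACA.
rewrite !tmod_funE linearP /= ract_linearl tens_linearl scalerDr addrACA.
congr (_ + _); rewrite scaler_sumr -big_split /=; apply: eq_bigr => x _.
by rewrite jac_linear linearP /= ract_linearl tens_linearl.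
Qed.

Lemma tmod_act_br D D' t : tmod_act (witt_br D D') t
  = tmod_act D (tmod_act D' t) - tmod_act D' (tmod_act D t).
Proof.
elim/tens_ind: t => [|p v t ih]; first by rewrite !linear0 addr0.
rewrite !linearD /= ih.
suff : tmod_act (witt_br D D') (tens p v) =
    tmod_act D (tmod_act D' (tens p v)) - tmod_act D' (tmod_act D (tens p v)).
  move: (tmod_act (witt_br D D') (tens p v)).
  move: (tmod_act D (tmod_act D' (tens p v))).
  move: (tmod_act D' (tmod_act D (tens p v))).
  by move=> a b d ->; rewrite addrACA.
clear t ih.
pose q D D' := \sum_x \sum_y
  tens (ract (wpoly (jac D y * jac D' x)) p)
       (lie_act (E y.1 y.2) (lie_act (E x.1 x.2) v)).
have actE D1 D2 : tmod_act D1 (tmod_act D2 (tens p v)) =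
    tens (ract (witt_weyl D1 * witt_weyl D2) p) v
    + (\sum_x tens (ract (wpoly (jac D1 x) * witt_weyl D2
         + wpoly (jac D2 x) * witt_weyl D1) p) (lie_act (E x.1 x.2) v)
    + (\sum_x tens (ract (wpoly (D1 (jac D2 x))) p) (lie_act (E x.1 x.2) v)
    + q D1 D2)).
  rewrite tmod_act_tens [tmod_fun D2 _ _]tmod_funE linearD /=.
  rewrite tmod_act_tens tmod_funE ractM -addrA; congr (_ + _).
  rewrite raddf_sum /= !addrA -!big_split /=; apply: eq_bigr => x _.
  rewrite tmod_act_tens tmod_funE -!ractM witt_weyl_poly !addrA; congr (_ + _).
    by rewrite !ractD !tensDl addrA.
  by apply: eq_bigr => y _; rewrite -ractM wpolyM.
rewrite tmod_act_tens tmod_funE !actE witt_weyl_br ractB tensBl.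
rewrite [\sum_x tens (ract (wpoly (jac D' x) * _ + _) p) _](eq_bigr
  (fun x => tens (ract (wpoly (jac D x) * witt_weyl D'
     + wpoly (jac D' x) * witt_weyl D) p) (lie_act (E x.1 x.2) v)));
  last by move=> x _; rewrite addrC.
have tele (a1 a2 S l1 l2 q1 q2 : T) :
    (a1 + (S + (l1 + q1))) - (a2 + (S + (l2 + q2)))
    = (a1 - a2) + ((l1 - l2) + (q1 - q2)).
  rewrite opprD addrACA; congr (_ + _).
  by rewrite opprD addrACA subrr add0r opprD addrACA.
rewrite tele {tele}; congr (_ + _); rewrite -sumrB.
have -> : q D D' - q D' D = \sum_x tens (ract (wpoly
    (\sum_(k < n) (jac D (x.1, k) * jac D' (k, x.2)
                   - jac D' (x.1, k) * jac D (k, x.2)))) p) (lie_act (E x.1 x.2) v).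
  rewrite /q [X in _ - X]exchange_big /= -sumrB.
  pose G k j i k' : T := tens (ract (wpoly (jac D (i, k') * jac D' (k, j))) p)
    (lie_act (E i j) v).
  pose H k j i k' : T := tens (ract (wpoly (jac D' (i, k') * jac D (k, j))) p)
    (lie_act (E i j) v).
  transitivity (\sum_(x : 'I_n * 'I_n) \sum_(y : 'I_n * 'I_n)
     G x.1 x.2 y.1 y.2 *+ (y.2 == x.1) - \sum_(x : 'I_n * 'I_n)
     \sum_(y : 'I_n * 'I_n) H x.1 x.2 y.1 y.2 *+ (y.2 == x.1)).
    rewrite [X in _ = _ - X]exchange_big /= -sumrB; apply: eq_bigr => x _.
    rewrite -!sumrB; apply: eq_bigr => y _.
    rewrite [jac D' x * _]mulrC -linearB /= -lie_act_br /gl_br.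
    rewrite !mul_delta_mx_cond /G /H -!surjective_pairing.
    have -> : lie_act (E y.1 x.2 *+ (y.2 == x.1) - E x.1 y.2 *+ (x.2 == y.1)) v
      = lie_act (E y.1 x.2) v *+ (y.2 == x.1)
        - lie_act (E x.1 y.2) v *+ (x.2 == y.1).
      have lB A B : lie_act (A - B) v = lie_act A v - lie_act B v.
        by have := lie_act_linearl v (-1) B A; rewrite !scaleN1r ![- _ + _]addrC.
      rewrite lB; have l0 : lie_act (0 : 'M[F]_n) v = 0.
        by rewrite -(subrr 0) lB subrr.
      by do 2!case: (_ == _); rewrite ?mulr1n ?mulr0n ?l0.
    by rewrite linearB !linearMn [jac D' x * _]mulrC.
  rewrite !sum_pair_delta -sumrB; apply: eq_bigr => z _.
  rewrite [wpoly (\sum_(k < n) _)]linear_sum ract_suml tens_suml -sumrB; apply: eq_bigr => k _.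
  by rewrite linearB ractB tensBl.
rewrite -big_split /=; apply: eq_bigr => x _.
by rewrite jac_br linearD linearB /= ractD ractB tensDl tensBl.
Qed.

Definition tensor_module : lieModule (@witt_br F n) :=
  LieModule tmod_act_linear tmod_act_linearl tmod_act_br.

Lemma tensor_module_vf (a : 'X_{1..n}) (j : 'I_n) (p : restrict P) (v : V) :
  tmod_act (wvf 'X_[a] j) (tens p v)
  = tens (ract (wpoly 'X_[a] * wder F j) p) v
    + \sum_(i < n) tens (ract (wpoly (mderiv i 'X_[a])) p) (lie_act (E i j) v).
Proof.
have wvfE k : wvf ('X_[a] : O) j 'X_k = 'X_[a] * mderiv j 'X_k by [].
rewrite tmod_act_tens /tmod_fun; congr (_ + _).
  by congr (tens (ract _ p) v); apply: weylP.
apply: eq_bigr => i _; rewrite (bigD1 j) // big1 => [|k kj].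
  by rewrite wvfE mderivX_ord eqxx mulr1; exact: addr0.
by rewrite wvfE mderivX_ord (negPf kj) mulr0 mderiv0 linear0 /ract scale0r tens0l.
Qed.

End TensorModule.

Definition locally_nilpotent (M : nmodType) (f : M -> M) : Prop :=
  forall m, exists k : nat, iter k f m = 0.

Definition simple_module (A : pzRingType) (M : lmodType A) : Prop :=
  (exists m : M, m != 0) /\
  forall S : set M, S 0 -> (forall m p, S m -> S p -> S (m + p)) ->
    (forall (u : A) m, S m -> S (u *: m)) -> S = [set 0]%classic \/ S = setT.

Definition simple_lieModule (F : fieldType) (g : lmodType F) (br : g -> g -> g)
    (V : lieModule br) : Prop :=
  (exists v : V, v != 0) /\
  forall S : set V, S 0 -> (forall v w, S v -> S w -> S (v + w)) ->
    (forall (c : F) v, S v -> S (c *: v)) ->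
    (forall (X : g) v, S v -> S (lie_act X v)) -> S = [set 0]%classic \/ S = setT.

Section Weights.
Variables (F : fieldType) (n : nat) (M : lmodType F) (h : 'I_n -> M -> M).

Definition weight_space (lam : 'rV[F]_n) : set M :=
  [set m | forall i, h i m = lam 0 i *: m]%classic.

(* [M] is the direct sum of its weight spaces: every vector is a finite sum of
   weight vectors, and weight vectors of distinct weights are independent. *)
Definition weight_decomposable : Prop :=
  (forall m : M, exists (s : seq 'rV[F]_n) (f : 'rV[F]_n -> M),
     [/\ uniq s, forall lam, weight_space lam (f lam)
       & m = \sum_(lam <- s) f lam]) /\
  (forall (s : seq 'rV[F]_n) (f : 'rV[F]_n -> M),
     uniq s -> (forall lam, weight_space lam (f lam)) ->
     \sum_(lam <- s) f lam = 0 -> {in s, forall lam, f lam = 0}).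

Definition finite_dim (S : set M) : Prop :=
  exists (k : nat) (b : 'I_k -> M), (forall i, S (b i)) /\
    forall m, S m -> exists c : 'I_k -> F, m = \sum_(i < k) c i *: b i.

Definition finite_multiplicities : Prop :=
  forall lam : 'rV[F]_n, finite_dim (weight_space lam).
End Weights.

Section CartanActions.
Variables (F : fieldType) (n : nat).

Definition weyl_cartan (P : lmodType (weyl F n)) (i : 'I_n) :
    restrict P -> restrict P :=
  ract (wpoly 'X_i * wder F i).

Definition gl_cartan (V : lieModule (@gl_br F n)) (i : 'I_n) : V -> V :=
  lie_act (delta_mx i i : 'M[F]_n).

Definition witt_cartan (W : lieModule (@witt_br F n)) (i : 'I_n) : W -> W :=
  lie_act (wvf ('X_i : {mpoly F[n]}) i).
End CartanActions.

Arguments weyl_cartan {F n} P i _.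
Arguments gl_cartan {F n} V i _.
Arguments witt_cartan {F n} W i _.

Section Shadows.
Variables (F : fieldType) (n : nat).
Local Open Scope classical_set_scope.

(* The root [eps_i - eps_j]; its root vector in gl(n) is the matrix unit
   [delta_mx i j]. *)
Definition root (i j : 'I_n) : 'rV[int]_n := delta_mx 0 i - delta_mx 0 j.

Definition gl_roots_where (Q : 'I_n -> 'I_n -> Prop) : set 'rV[int]_n :=
  [set a | exists i j, [/\ i != j, a = root i j & Q i j]].

Section GlModule.
Variable V : lieModule (@gl_br F n).
Local Notation X i j := (lie_act (delta_mx i j : 'M[F]_n) : V -> V).

Definition DeltaF_gl := gl_roots_where
  (fun i j => locally_nilpotent (X i j) /\ locally_nilpotent (X j i)).
Definition DeltaI_gl := gl_roots_where
  (fun i j => injective (X i j) /\ injective (X j i)).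
Definition Deltap_gl := gl_roots_where
  (fun i j => locally_nilpotent (X i j) /\ injective (X j i)).
Definition Deltam_gl := [set - a | a in Deltap_gl].
End GlModule.

Section WeylModule.
Variable P : lmodType (weyl F n).
Local Notation x i := (fun p : P => wpoly 'X_i *: p).
Local Notation d i := (fun p : P => wder F i *: p).

Definition Iplus : set 'I_n :=
  [set i | locally_nilpotent (d i) /\ injective (x i)].
Definition Iminus : set 'I_n :=
  [set i | locally_nilpotent (x i) /\ injective (d i)].
Definition Izero : set 'I_n :=
  [set i | injective (x i) /\ injective (d i)].

Definition DeltaI_weyl := gl_roots_where (fun i j => Izero i /\ Izero j).
Definition DeltaF_weyl := gl_roots_where
  (fun i j => (Iplus i /\ Iplus j) \/ (Iminus i /\ Iminus j)).
Definition Deltam_weyl := gl_roots_where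
  (fun i j => (Iplus i /\ ~ Iplus j) \/ (~ Iminus i /\ Iminus j)).
Definition Deltap_weyl := [set - a | a in Deltam_weyl].
End WeylModule.
End Shadows.

(* Main.v *)
(* The weight space of T(P,V) of weight lam is the sum of the P^mu (x) V^nu with
   mu + nu = lam. All weight spaces of P are lines: for a weight vector p, the
   vectors x^a p (a in Z^n, negative powers of x_i being powers of d_i) span P.
   So the multiplicities are finite iff, for each lam, only finitely many a have
   x^a p <> 0 and V^(lam - mu - a) <> 0.

   If x_i and d_j are injective on P and E_ji is injective on V, the vectors
   (x_i d_j)^k p (x) E_ji^k v all lie in one weight space and are independent.
   Otherwise, put sgn = 1 on I^-, -1 on I^+ and 0 on I^0. All E_ij with
   sgn i >= 0 >= sgn j are locally nilpotent on V. Straightening the words in the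
   E_ij so that these letters act first shows that, up to finitely many
   possibilities, each weight of V is reached from a given one by adding roots
   e_i - e_j with sgn i < sgn j or sgn i = sgn j <> 0. None of these increases
   sum_i sgn_i nu_i, whereas the support of P bounds each sgn_i nu_i from below;
   this leaves finitely many weights. *)

From HB Require Import structures.
Require Import Defs.
From mathcomp Require Import all_boot all_order all_algebra.
From mathcomp Require Import complex boolp classical_sets reals.
From mathcomp Require Import mpoly zify.

Set Implicit Arguments.
Unset Strict Implicit.
Unset Printing Implicit Defensive.

Import Order.TTheory GRing.Theory Num.Theory.
Local Open Scope ring_scope.

(** * Linear spans and finite-dimensional subspaces *)

Section Span.
Variables (F : fieldType) (M : lmodType F).
Implicit Types (G H : M -> Prop) (m : M).

(** The generators form a predicate, possibly with infinitely many elements; the inductive form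
    allows induction on the summands without indexed families. *)
Inductive inspan G : M -> Prop :=
| Inspan0 : inspan G 0
| InspanP c g m : G g -> inspan G m -> inspan G (c *: g + m).

Lemma inspan_gen G g : G g -> inspan G g.
Proof. by move=> Gg; rewrite -[g]addr0 -[g]scale1r; apply: InspanP => //; exact: Inspan0. Qed.

Lemma inspanD G m1 m2 : inspan G m1 -> inspan G m2 -> inspan G (m1 + m2).
Proof.
move=> s1 s2; elim: s1 => [|c g m Gg _ ih]; first by rewrite add0r.
by rewrite -addrA; exact: InspanP.
Qed.

Lemma inspanZ G c m : inspan G m -> inspan G (c *: m).
Proof.
elim=> [|d g u Gg _ ih]; first by rewrite scaler0; exact: Inspan0.
by rewrite scalerDr scalerA; exact: InspanP.
Qed.

Lemma inspanN G m : inspan G m -> inspan G (- m).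
Proof. by rewrite -scaleN1r; exact: inspanZ. Qed.

Lemma inspanB G m1 m2 : inspan G m1 -> inspan G m2 -> inspan G (m1 - m2).
Proof. by move=> s1 s2; apply: inspanD => //; exact: inspanN. Qed.

Lemma inspan_sum G I (r : seq I) (Q : pred I) (f : I -> M) :
  (forall i, Q i -> inspan G (f i)) -> inspan G (\sum_(i <- r | Q i) f i).
Proof.
by move=> Gf; elim/big_ind: _ => //; [exact: Inspan0 | exact: inspanD].
Qed.

Lemma inspan_trans G H m :
  (forall g, G g -> inspan H g) -> inspan G m -> inspan H m.
Proof.
move=> GH; elim=> [|c g u Gg _ ih]; first exact: Inspan0.
by apply: inspanD => //; apply: inspanZ; exact: GH.
Qed.

Lemma inspan_sub G H m : (forall g, G g -> H g) -> inspan G m -> inspan H m.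
Proof. by move=> GH; apply: inspan_trans => g /GH; exact: inspan_gen. Qed.

Lemma finite_dim_seq (S : set M) : finite_dim S ->
  exists s : seq M, (forall m, m \in s -> S m) /\
    forall m, S m -> inspan (fun g => g \in s) m.
Proof.
move=> [k [b [bS Sb]]]; exists (codom b); split=> [m /codomP[i ->] //|m /Sb[c ->]].
apply: inspan_sum => i _; apply: inspanZ; apply: inspan_gen; exact: codom_f.
Qed.

Lemma finite_dim_inspan (S : set M) (b : seq M) :
  (forall m, m \in b -> S m) -> (forall m, S m -> inspan (fun g => g \in b) m) ->
  finite_dim S.
Proof.
move=> bS Sb; exists (size b), (fun i => b`_i); split=> [i|m /Sb].
  by apply: bS; exact: mem_nth.
elim=> [|c g u gb _ [d ->]].
  by exists (fun=> 0); rewrite big1 // => i _; rewrite scale0r.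
have gi : (index g b < size b)%N by rewrite index_mem.
(* [b] may contain repetitions; the new coefficient goes to the first occurrence of [g]. *)
exists (fun i => d i + c *+ (i == Ordinal gi)).
under [RHS]eq_bigr do rewrite scalerDl.
rewrite big_split /= addrC; congr (_ + _).
rewrite (bigD1 (Ordinal gi)) //= eqxx mulr1n nth_index // big1 ?addr0 // => i.
by move/negPf->; rewrite mulr0n scale0r.
Qed.

(** Over a spanning family of k vectors, the coefficients of the first k + 1 terms form a matrix
    with more rows than columns; a nonzero row of its left kernel is the relation. *)
Lemma finite_dim_dependent (S : set M) (t : nat -> M) :
  finite_dim S -> (forall k, S (t k)) ->
  exists k (d : 'I_k -> F), (exists i, d i != 0) /\ \sum_(i < k) d i *: t i = 0.
Proof.
move=> [k [b [_ Sb]]] St.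
have /choice[c cE] : forall j, exists c : 'I_k -> F, t j = \sum_(i < k) c i *: b i.
  by move=> j; exact: Sb.
pose C : 'M[F]_(k.+1, k) := \matrix_(i, j) c i j.
have /rowV0Pn[d /sub_kermxP dC d0] : kermx C != 0.
  by rewrite kermx_eq0 /row_free neq_ltn ltnS rank_leq_col.
exists k.+1, (d 0); split.
  apply/existsP; apply: contraNT d0; rewrite negb_exists => /forallP d0.
  by apply/eqP/rowP => i; rewrite mxE; apply/eqP; rewrite -[_ == _]negbK.
under eq_bigr => i _ do rewrite cE scaler_sumr.
rewrite exchange_big big1 //= => j _.
under eq_bigr => i _ do rewrite scalerA.
rewrite -scaler_suml (_ : \sum_(i < k.+1) _ = 0) ?scale0r //.
have := congr1 (fun A : 'rV_k => A 0 j) dC; rewrite mxE [RHS]mxE => dCj.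
rewrite -[RHS]dCj; by apply: eq_bigr => i _; rewrite mxE.
Qed.
End Span.

Lemma inspan_linear (F : fieldType) (M N : lmodType F) (f : {linear M -> N}) (G : M -> Prop)
    (H : N -> Prop) m :
  (forall g, G g -> inspan H (f g)) -> inspan G m -> inspan H (f m).
Proof.
move=> GH; elim=> [|c g u Gg _ ih]; first by rewrite linear0; exact: Inspan0.
by rewrite linearP; apply: inspanD => //; apply: inspanZ; exact: GH.
Qed.

(** * Weight vectors and weight components *)

Section WeightTheory.
Variables (F : fieldType) (n : nat) (M : lmodType F).
Variable h : 'I_n -> {linear M -> M}.
Local Notation W := (@weight_space F n M h).

Lemma weight_spaceD lam u v : W lam u -> W lam v -> W lam (u + v).
Proof. by move=> uW vW i; rewrite linearD uW vW scalerDr. Qed.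

Lemma weight_spaceZ lam c u : W lam u -> W lam (c *: u).
Proof. by move=> uW i; rewrite linearZ /= uW !scalerA mulrC. Qed.

Lemma weight_space0 lam : W lam 0.
Proof. by move=> i; rewrite linear0 scaler0. Qed.

Lemma weight_unique lam mu u : u != 0 -> W lam u -> W mu u -> lam = mu.
Proof.
move=> u0 uW uW'; apply/rowP => i; apply/eqP; rewrite -subr_eq0.
have : (lam 0 i - mu 0 i) *: u = 0 by rewrite scalerBl -uW -uW' subrr.
by move/eqP; rewrite scaler_eq0 (negPf u0) orbF.
Qed.

(** The map is a product of factors (h_i - mu_i) / (lam_i - mu_i), one for each mu in [s], where i
    is a coordinate in which lam and mu differ. Such a factor is a scalar on every weight space: 1
    for lam and 0 for mu. *)
Lemma weight_separate (lam : 'rV[F]_n) (s : seq 'rV[F]_n) : lam \notin s ->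
  exists f : {linear M -> M}, (forall m, W lam m -> f m = m) /\
    (forall mu, mu \in s -> forall m, W mu m -> f m = 0).
Proof.
elim: s => [|mu s ih]; first by exists idfun; split.
rewrite inE negb_or => /andP[lam_mu /ih[f [f1 f0]]].
have [i lamE] : exists i, lam 0 i != mu 0 i.
  apply/existsP; apply: contraNT lam_mu; rewrite negb_exists => /forallP E.
  by apply/eqP/rowP => i; apply/eqP; rewrite -[_ == _]negbK.
have {}lamE : lam 0 i - mu 0 i != 0 by rewrite subr_eq0.
pose k : {linear M -> M} :=
  (lam 0 i - mu 0 i)^-1 \*: (h i \- (mu 0 i \*: idfun)) : {linear M -> M}.
have kE nu m : W nu m -> k m = ((lam 0 i - mu 0 i)^-1 * (nu 0 i - mu 0 i)) *: m.
  by move=> mW; rewrite /k /= mW -scalerBl scalerA.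
exists (f \o k : {linear M -> M}); split=> [m mW|nu].
  by transitivity (f (k m)); rewrite // (kE _ _ mW) mulVf // scale1r f1.
rewrite inE => /predU1P[-> m mW|nu_s m mW]; transitivity (f (k m)) => //.
  by rewrite (kE _ _ mW) subrr mulr0 scale0r linear0.
by rewrite (kE _ _ mW) linearZ /= (f0 nu) ?scaler0.
Qed.

(* A linear map separating [lam] from the finitely many other weights that occur
   in [u] projects [u] to its component of weight [lam]. *)
Lemma inspan_weight (G : M -> Prop) lam u :
  (forall g, G g -> exists mu, W mu g) -> inspan G u -> W lam u ->
  inspan (fun g => G g /\ W lam g) u.
Proof.
move=> GW Gu uW.
(* [u'] collects the summands of weight [lam] and [s] the weights of the others, so a map that
   vanishes on the latter agrees on [u] and [u']. *)
have [u' [su' [s [sE fE]]]] : exists u', inspan (fun g => G g /\ W lam g) u' /\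
    exists s : seq 'rV[F]_n, lam \notin s /\ forall f : {linear M -> M},
      (forall mu, mu \in s -> forall m, W mu m -> f m = 0) -> f u = f u'.
  elim: Gu {uW} => [|c g v Gg _ [v' [sv' [s [sE fE]]]]].
    by exists 0; split; [exact: Inspan0 | exists [::]].
  have [mu gW] := GW _ Gg; have [mu_lam|mu_lam] := eqVneq mu lam.
    rewrite mu_lam in gW; exists (c *: g + v'); split; first exact: InspanP.
    by exists s; split=> // f f0; rewrite !linearP fE.
  exists v'; split=> //; exists (mu :: s); split.
    by rewrite inE negb_or eq_sym mu_lam.
  move=> f f0; rewrite linearP (f0 mu) ?mem_head // scaler0 add0r fE // => nu.
  by move=> nu_s; apply: f0; rewrite inE nu_s orbT.
have [f [f1 f0]] := weight_separate sE.
rewrite -(f1 u uW) (fE f f0) f1 //.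
have {}uW : forall v, inspan (fun g => G g /\ W lam g) v -> W lam v.
  move=> v; elim=> [|c g w [_ gW] _ wW]; first exact: weight_space0.
  by apply: weight_spaceD => //; exact: weight_spaceZ.
exact: uW.
Qed.

Lemma weight_decomposable_span : weight_decomposable h ->
  forall m, inspan (fun g => exists lam, W lam g) m.
Proof.
move=> [dec _] m; have [s [f [_ fW ->]]] := dec m.
by apply: inspan_sum => lam _; apply: inspan_gen; exists lam.
Qed.

Lemma exists_weight_vector : weight_decomposable h -> (exists m : M, m != 0) ->
  exists lam m, W lam m /\ m != 0.
Proof.
move=> hd [m m0]; apply: contrapT => noW.
have g0 g : (exists lam, W lam g) -> g = 0.
  by move=> [lam gW]; apply/eqP; apply: contrapT => /negP g0; apply: noW; exists lam, g.
case/negP: m0; apply/eqP; elim: (weight_decomposable_span hd m) => // c g v /g0 -> _ ->.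
by rewrite scaler0 addr0.
Qed.
End WeightTheory.

(** * Locally nilpotent operators *)

Section Nilpotent.
Variable M : zmodType.

(* If [C = A B - B A] moves the kernel of [A^k] into that of [A^(k+N)], then [B]
   moves it into that of [A^(k+N+1)]. *)
Lemma iter_commutator (A B C : {additive M -> M}) N :
  (forall m, A (B m) = B (A m) + C m) ->
  (forall k m, iter k A m = 0 -> iter (k + N) A (C m) = 0) ->
  forall k m, iter k A m = 0 -> iter (k + N.+1) A (B m) = 0.
Proof.
move=> AB AC; elim=> [m /= ->|k ih m Akm].
  by rewrite raddf0 /=; elim: N {AC} => [|N ih] /=; rewrite ?ih raddf0.
have iD j u v : iter j A (u + v) = iter j A u + iter j A v.
  by elim: j => //= j ->; rewrite raddfD.
rewrite addSn iterSr AB iD addnS -[(k + N).+1]addnS ih -?iterSr //.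
by rewrite addnS -addSn AC // addr0.
Qed.

(** The set of vectors killed by some power of [A] contains the kernel of [A]. The applications show
    that it is a submodule of a simple module. *)
Lemma injective_or_locally_nilpotent (A : {additive M -> M}) :
  (forall S : set M, S = [set m | exists k, iter k A m = 0]%classic ->
     S = [set 0]%classic \/ S = setT) ->
  injective A \/ locally_nilpotent A.
Proof.
case/(_ _ erefl) => S0; [left|right] => [u v uv|m].
  apply/eqP; rewrite -subr_eq0; apply/eqP.
  have : [set m | exists k, iter k A m = 0]%classic (u - v).
    by exists 1%N; rewrite /= raddfB uv subrr.
  by rewrite S0.
by have : [set m | exists k, iter k A m = 0]%classic m by rewrite S0.
Qed.

(** Started at a weight vector, this gives a weight vector in the kernel of [A], which pins down a
    coordinate of the weight. *)
Lemma locally_nilpotent_last (A : {additive M -> M}) m :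
  locally_nilpotent A -> m != 0 ->
  exists k, iter k A m != 0 /\ A (iter k A m) = 0.
Proof.
move=> /(_ m) An m0; have ex : exists k, iter k A m == 0.
  by have [k kE] := An; exists k; rewrite kE.
case: (ex_minnP ex) => [[|k] /eqP kE kmin]; first by rewrite -kE eqxx in m0.
by exists k; split=> //; apply/negP => /kmin; rewrite ltnn.
Qed.
End Nilpotent.

(** In the noncommutative product, [y] passes the factors before the i-th, is traded there for [u],
    and [u] travels back to the front. This is how a generator multiplies a monomial of the Weyl
    algebra. *)
Lemma prod_update (R : nzRingType) (I : eqType) (s : seq I) (f g : I -> R)
    (i : I) (y u : R) :
  uniq s -> i \in s ->
  (forall j, j != i -> f j = g j /\ GRing.comm y (f j) /\ GRing.comm u (f j)) ->
  y * f i = u * g i ->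
  y * \prod_(j <- s) f j = u * \prod_(j <- s) g j.
Proof.
move=> + + fg yf; elim: s => // j s ih /= /andP[js us].
rewrite inE !big_cons; have [ij _|ij /= si] := eqVneq i j.
  subst j; have -> : \prod_(k <- s) f k = \prod_(k <- s) g k.
    apply: eq_big_seq => k ks; have [|//] := fg k.
    by apply: contraNneq js => <-.
  by rewrite !mulrA yf.
have [|fgj [yj uj]] := fg j; first by rewrite eq_sym.
by rewrite mulrA yj -mulrA ih // mulrA -uj -mulrA fgj.
Qed.

(** * Commutation rules and monomials in the Weyl algebra *)

Section WeylAlgebra.
Variables (F : fieldType) (n : nat).
Local Notation x i := (wpoly ('X_i : {mpoly F[n]})).
Local Notation d i := (wder F (i : 'I_n)).

Lemma weyl_ind (Q : weyl F n -> Prop) :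
  (forall i, Q (x i)) -> (forall i, Q (d i)) -> Q 1 ->
  (forall c u v, Q u -> Q v -> Q (c *: u + v)) ->
  (forall u v, Q u -> Q v -> Q (u * v)) -> forall u, Q u.
Proof.
move=> Qx Qd Q1 QP QM [e eP]; have /weyl_predP de := eP.
elim: de eP => [i|i||c u v du IHu dv IHv|u v du IHu dv IHv] eP.
- by have -> : Weyl eP = x i by exact: weylP.
- by have -> : Weyl eP = d i by exact: weylP.
- by have -> : Weyl eP = 1 by exact: weylP.
- have /weyl_predP du' := du; have /weyl_predP dv' := dv.
  have -> : Weyl eP = c *: Weyl du' + Weyl dv' by apply: weylP; rewrite weyl_opL.
  exact: QP.
- have /weyl_predP du' := du; have /weyl_predP dv' := dv.
  have -> : Weyl eP = Weyl du' * Weyl dv' by apply: weylP; rewrite weyl_opM.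
  exact: QM.
Qed.

Lemma comm_wpoly i j : GRing.comm (x i) (x j).
Proof. by rewrite /GRing.comm -!wpolyM mulrC. Qed.

Lemma comm_wder i j : GRing.comm (d i) (d j).
Proof.
apply: weylP; rewrite !weyl_opM; apply: endoP => f.
by rewrite !endoME /= mderiv_comm.
Qed.

Lemma wder_wpoly i j : d i * x j = x j * d i + ((j == i)%:R : F)%:A.
Proof.
apply: weylP; rewrite addrC weyl_opL !weyl_opM; apply: endoP => f.
rewrite endoDE endoZE !endoME /= mderivM mderivX_ord; congr (_ + _).
by case: (j == i); rewrite ?mul1r ?mul0r ?scale1r ?scale0r.
Qed.

Lemma comm_wpoly_wder i j : i != j -> GRing.comm (x i) (d j).
Proof. by move=> /negPf ij; rewrite /GRing.comm wder_wpoly ij scale0r addr0. Qed.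

Definition wpow (i : 'I_n) (z : int) : weyl F n :=
  match z with Posz k => x i ^+ k | Negz k => d i ^+ k.+1 end.

Lemma comm_wpow (y : weyl F n) i z :
  GRing.comm y (x i) -> GRing.comm y (d i) -> GRing.comm y (wpow i z).
Proof. by case: z => k yx yd; apply: commrX. Qed.

Lemma comm_wpoly_wpow i j z : j != i -> GRing.comm (x i) (wpow j z).
Proof.
move=> ji; apply: comm_wpow; first exact: comm_wpoly.
by apply: comm_wpoly_wder; rewrite eq_sym.
Qed.

Lemma comm_wder_wpow i j z : j != i -> GRing.comm (d i) (wpow j z).
Proof.
by move=> ji; apply: comm_wpow; [exact/commr_sym/comm_wpoly_wder | exact: comm_wder].
Qed.

(** The factor x_i d_i arises when x_i meets a power of d_i. It acts on weight vectors by scalars,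
    so on them a generator permutes the monomials up to scalars. *)
Lemma wpoly_wpow i z : exists u, [/\ u = 1 \/ u = x i * d i &
  x i * wpow i z = u * wpow i (z + 1)].
Proof.
case: z => k.
  by exists 1; split; [left | rewrite mul1r -PoszD addn1 /= exprS].
exists (x i * d i); split; first by right.
rewrite NegzE -addn1 PoszD opprD addrNK; case: k => [|k]; first by rewrite mulr1.
by rewrite -opprD -PoszD addn1 -!NegzE /= [d i ^+ k.+2]exprS mulrA.
Qed.

Lemma wder_wpow i z : exists u, [/\ u = 1 \/ u = d i * x i &
  d i * wpow i z = u * wpow i (z - 1)].
Proof.
case: z => [[|k]|k].
- by exists 1; split; [left | rewrite mul1r sub0r /= expr1 mulr1].
- exists (d i * x i); split; first by right.
  by rewrite -addn1 PoszD addrK /= addn1 exprS mulrA.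
- exists 1; split; first by left.
  by rewrite mul1r NegzE -opprD -PoszD addn1 -NegzE /= -exprS.
Qed.

(* The monomial [x^a], where negative powers of [x_i] stand for powers of [d_i]. *)
Definition wmono (a : 'rV[int]_n) : weyl F n := \prod_(i < n) wpow i (a 0 i).

Lemma wmono0 : wmono 0 = 1.
Proof. by rewrite /wmono big1 // => i _; rewrite mxE. Qed.

Lemma wpoly_wmono i a : exists u, [/\ u = 1 \/ u = x i * d i &
  x i * wmono a = u * wmono (a + delta_mx 0 i)].
Proof.
have [u [uE xE]] := wpoly_wpow i (a 0 i); exists u; split=> //.
apply: prod_update (index_enum_uniq _) (mem_index_enum i) _ _ => [j ji|]; last first.
  by rewrite !mxE !eqxx xE.
split; first by rewrite !mxE (negPf ji) addr0.
split; first exact: comm_wpoly_wpow.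
case: uE => ->; first exact/commr_sym/commr1.
apply/commr_sym/commrM; apply/commr_sym;
  [exact: comm_wpoly_wpow | exact: comm_wder_wpow].
Qed.

Lemma wder_wmono i a : exists u, [/\ u = 1 \/ u = d i * x i &
  d i * wmono a = u * wmono (a - delta_mx 0 i)].
Proof.
have [u [uE dE]] := wder_wpow i (a 0 i); exists u; split=> //.
apply: prod_update (index_enum_uniq _) (mem_index_enum i) _ _ => [j ji|]; last first.
  by rewrite !mxE !eqxx dE.
split; first by rewrite !mxE (negPf ji) subr0.
split; first exact: comm_wder_wpow.
case: uE => ->; first exact/commr_sym/commr1.
apply/commr_sym/commrM; apply/commr_sym;
  [exact: comm_wder_wpow | exact: comm_wpoly_wpow].
Qed.
End WeylAlgebra.

(** * Simple weight modules over the Weyl algebra *)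

Section WeylModules.
Variables (F : numFieldType) (n : nat) (P : lmodType (weyl F n)).
Local Notation x i := (wpoly ('X_i : {mpoly F[n]})).
Local Notation d i := (wder F (i : 'I_n)).
Local Notation rP := (Defs.restrict P).
Local Notation W := (weight_space (weyl_cartan P)).
Local Notation "a %:FM" := (map_mx intr a : 'rV[F]_n) (at level 2).

Lemma ract_scalar c (p : rP) : ract (c%:A : weyl F n) p = c *: p.
Proof. by []. Qed.

Lemma weyl_weight_wpoly lam i (p : rP) :
  W lam p -> W (lam + delta_mx 0 i) (ract (x i) p).
Proof.
move=> pW j; rewrite /weyl_cartan -ractM -mulrA wder_wpoly mulrDr mulrA comm_wpoly.
rewrite -mulrA ractD ractM -/(weyl_cartan P j p) pW linearZ /= !mxE eqxx /= eq_sym scalerDl.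
congr (_ + _); have [->|_] := eqVneq i j; first by rewrite !scale1r mulr1.
by rewrite !scale0r mulr0 /ract scale0r.
Qed.

Lemma weyl_weight_wder lam i (p : rP) :
  W lam p -> W (lam - delta_mx 0 i) (ract (d i) p).
Proof.
move=> pW j; rewrite /weyl_cartan -ractM -mulrA comm_wder mulrA.
have -> : x j * d i = d i * x j - ((j == i)%:R : F)%:A by rewrite wder_wpoly addrK.
rewrite mulrBl ractB -mulrA ractM -/(weyl_cartan P j p) pW linearZ /= !mxE eqxx /= scalerBl.
congr (_ - _); have [->|_] := eqVneq j i; first by rewrite !scale1r mul1r.
by rewrite !scale0r mul0r /ract scale0r.
Qed.

Lemma weyl_weight_wpow lam i z (p : rP) :
  W lam p -> W (lam + z%:~R *: delta_mx 0 i) (ract (wpow F i z) p).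
Proof.
move=> pW; case: z => k; rewrite /wpow.
  elim: k => [|k ih]; first by rewrite scale0r addr0 expr0 /ract scale1r.
  by rewrite exprS ractM intS rmorphD scalerDl scale1r addrA addrAC;
    exact: weyl_weight_wpoly.
rewrite NegzE; elim: k => [|k ih].
  by rewrite scaleN1r expr1; exact: weyl_weight_wder.
by rewrite exprS ractM intS opprD rmorphD scalerDl scaleN1r addrA addrAC;
  exact: weyl_weight_wder.
Qed.

Lemma weyl_weight_wmono lam a (p : rP) :
  W lam p -> W (lam + a%:FM) (ract (wmono F a) p).
Proof.
move=> pW; rewrite [a in a%:FM]row_sum_delta raddf_sum /= /wmono.
elim: (index_enum _) => [|i s ih]; first by rewrite !big_nil addr0 /ract scale1r.
rewrite !big_cons addrCA addrC ractM.
rewrite map_mxZ map_delta_mx; exact: weyl_weight_wpow.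
Qed.

Lemma weyl_mono_wpoly lam i a (p : rP) : W lam p ->
  exists c : F, ract (x i * wmono F a) p = c *: ract (wmono F (a + delta_mx 0 i)) p.
Proof.
move=> pW; have [u [uE ->]] := wpoly_wmono F i a; rewrite ractM.
case: uE => ->; first by exists 1; rewrite /ract !scale1r.
by eexists; exact: (weyl_weight_wmono _ pW).
Qed.

Lemma weyl_mono_wder lam i a (p : rP) : W lam p ->
  exists c : F, ract (d i * wmono F a) p = c *: ract (wmono F (a - delta_mx 0 i)) p.
Proof.
move=> pW; have [u [uE ->]] := wder_wmono F i a; rewrite ractM.
case: uE => ->; first by exists 1; rewrite /ract !scale1r.
(* d_i x_i = x_i d_i + 1 acts on weight vectors by scalars as well. *)
eexists; rewrite wder_wpoly eqxx ractD.
rewrite [ract (x i * _) _](weyl_weight_wmono _ pW i) ract_scalar -scalerDl.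
by [].
Qed.

(** Each generator sends x^a p to a multiple of some x^b p, so the span of these vectors is a
    nonzero submodule. *)
Lemma simple_weyl_span (p : rP) lam : simple_module P -> p != 0 -> W lam p ->
  forall u : rP, inspan (fun g => exists a, g = ract (wmono F a) p) u.
Proof.
move=> [_ simpleP] p0 pW; pose S : set P := inspan (M := rP)
  (fun g => exists a, g = ract (wmono F a) p).
have SP : S p.
  by apply: (inspan_gen (M := rP)); exists 0; rewrite wmono0 /ract scale1r.
have Su (u : weyl F n) (m : rP) : S m -> S (ract u m).
  elim/weyl_ind: u m => [i|i||c u v IHu IHv|u v IHu IHv] m Sm.
  - elim: Sm => [|c _ v [a ->] _ ih]; first by rewrite linear0; exact: Inspan0.
    rewrite linearP /= -ractM; have [e ->] := weyl_mono_wpoly i a pW.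
    by rewrite scalerA; apply: InspanP ih; exists (a + delta_mx 0 i).
  - elim: Sm => [|c _ v [a ->] _ ih]; first by rewrite linear0; exact: Inspan0.
    rewrite linearP /= -ractM; have [e ->] := weyl_mono_wder i a pW.
    by rewrite scalerA; apply: InspanP ih; exists (a - delta_mx 0 i).
  - by rewrite /ract scale1r.
  - by rewrite ract_linearl; apply: inspanD; [apply: inspanZ; exact: IHu | exact: IHv].
  - by rewrite ractM; exact/IHu/IHv.
have [] := simpleP S; [exact: Inspan0 | exact: (@inspanD F rP) | exact: Su | | ].
  by move=> S0; move: SP p0; rewrite S0 => ->; rewrite eqxx.
by move=> ST u; have : S u by rewrite ST.
Qed.

(** By characteristic 0, distinct exponents shift a weight differently. *)
Lemma map_intr_inj : injective (fun a : 'rV[int]_n => a%:FM).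
Proof.
move=> a b /rowP ab; apply/rowP => i; have := ab i; rewrite !mxE => /eqP.
by rewrite eqr_int => /eqP.
Qed.

(** Among the nonzero vectors x^a p that span P, only the one with a = 0 has weight [lam]. *)
Lemma simple_weyl_weight_line lam (p q : rP) : simple_module P -> p != 0 ->
  W lam p -> W lam q -> exists c : F, q = c *: p.
Proof.
move=> sP p0 pW qW.
have Gspan := simple_weyl_span sP p0 pW q.
have GW (g : rP) : (exists a, g = ract (wmono F a) p) -> exists mu, W mu g.
  by move=> [a ->]; exists (lam + a%:FM); exact: weyl_weight_wmono.
elim: (inspan_weight GW Gspan qW) => [|c g v [[a ->] aW] _ [e ->]].
  by exists 0; rewrite scale0r.
have [->|g0] := eqVneq (ract (wmono F a) p) 0; first by exists e; rewrite scaler0 add0r.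
have := weight_unique g0 (weyl_weight_wmono a pW) aW.
rewrite -[RHS]addr0 => /addrI a0; have {}a0 : a = 0.
  by apply: map_intr_inj; rewrite a0 map_mx0.
by exists (c + e); rewrite a0 wmono0 /ract scale1r scalerDl.
Qed.

(** Scalars preserve the kernel of each power of [y], so [iter_commutator] with N = 0 shows that the
    vectors killed by powers of [y] are stable under all generators. *)
Lemma weyl_injective_or_nilpotent (y : weyl F n) : simple_module P ->
  (forall i, exists c : F, y * x i = x i * y + c%:A) ->
  (forall i, exists c : F, y * d i = d i * y + c%:A) ->
  injective (ract y : rP -> rP) \/ locally_nilpotent (ract y : rP -> rP).
Proof.
move=> [_ simpleP] yx yd; apply: (@injective_or_locally_nilpotent rP) => S SE.
have iL k (c : F) (u v : rP) :
    iter k (ract y) (c *: u + v) = c *: iter k (ract y) u + iter k (ract y) v.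
  by elim: k => //= k ->; rewrite linearP.
have i0 k : iter k (ract y) (0 : rP) = 0 by elim: k => //= k ->; rewrite linear0.
have SP (c : F) (u v : rP) : S u -> S v -> S (c *: u + v).
  rewrite SE => -[k kE] [l lE]; exists (k + l)%N.
  by rewrite iL [in iter _ _ v]iterD lE i0 addnC iterD kE i0 scaler0 addr0.
have comm z : (exists c : F, y * z = z * y + c%:A) -> forall m, S m -> S (ract z m).
  move=> [c yz] m; rewrite SE => -[k kE]; exists (k + 1)%N.
  apply: (@iter_commutator rP (ract y) (ract z) (ract c%:A) 0) => // [u|l u lE].
    by have := congr1 (fun t => ract t u) yz; rewrite ractD !ractM.
  by rewrite addn0; have := iL l c u 0; rewrite addr0 i0 lE scaler0 addr0.
apply: simpleP => [|u v uS vS|u m].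
- by rewrite SE; exists 0%N.
- by have := SP 1 u v uS vS; rewrite scale1r.
elim/weyl_ind: u m => [i|i||c u v IHu IHv|u v IHu IHv] m Sm.
- exact: comm (yx i) _ Sm.
- exact: comm (yd i) _ Sm.
- by rewrite scale1r.
- have -> : (c *: u + v) *: m = c *: ract u m + ract v m :> rP by exact: ract_linearl.
  by apply: SP; [exact: IHu | exact: IHv].
- by rewrite -scalerA; exact/IHu/IHv.
Qed.

Lemma wpoly_injective_or_nilpotent i : simple_module P ->
  injective (ract (x i) : rP -> rP) \/ locally_nilpotent (ract (x i) : rP -> rP).
Proof.
move=> sP; apply: weyl_injective_or_nilpotent => // j.
  by exists 0; rewrite comm_wpoly scale0r addr0.
by exists (- (i == j)%:R); rewrite wder_wpoly scaleNr addrK.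
Qed.

Lemma wder_injective_or_nilpotent i : simple_module P ->
  injective (ract (d i) : rP -> rP) \/ locally_nilpotent (ract (d i) : rP -> rP).
Proof.
move=> sP; apply: weyl_injective_or_nilpotent => // j.
  by exists (j == i)%:R; rewrite wder_wpoly.
by exists 0; rewrite comm_wder scale0r addr0.
Qed.

(** On the last nonzero vector d_i^k p the operator x_i d_i vanishes, and its eigenvalue there is
    lam_i - k. *)
Lemma wder_nilpotent_weight i lam (p : rP) :
  locally_nilpotent (ract (d i) : rP -> rP) -> p != 0 -> W lam p ->
  exists k : nat, lam 0 i = k%:R.
Proof.
move=> dn p0 pW; have [k [q0 dq]] := @locally_nilpotent_last rP _ _ dn p0.
have qW : W (lam - delta_mx 0 i *+ k) (iter k (ract (d i)) p).
  elim: k {q0 dq} => [|k ih]; first by rewrite mulr0n subr0.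
  by rewrite mulrS opprD addrCA addrC; exact: weyl_weight_wder.
exists k; have := qW i; rewrite /weyl_cartan ractM dq linear0 => /esym/eqP.
rewrite scaler_eq0 (negPf q0) orbF !mxE mulmxnE !mxE !eqxx subr_eq0 => /eqP ->.
by [].
Qed.

(** On the last nonzero vector x_i^k p the operator d_i x_i vanishes, so x_i d_i = d_i x_i - 1 has
    eigenvalue -1 there, which is lam_i + k. *)
Lemma wpoly_nilpotent_weight i lam (p : rP) :
  locally_nilpotent (ract (x i) : rP -> rP) -> p != 0 -> W lam p ->
  exists k : nat, lam 0 i = - k.+1%:R.
Proof.
move=> xn p0 pW; have [k [q0 xq]] := @locally_nilpotent_last rP _ _ xn p0.
have qW : W (lam + delta_mx 0 i *+ k) (iter k (ract (x i)) p).
  elim: k {q0 xq} => [|k ih]; first by rewrite mulr0n addr0.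
  by rewrite mulrS addrCA addrC; exact: weyl_weight_wpoly.
exists k; have : ract (d i * x i) (iter k (ract (x i)) p) = 0.
  by rewrite ractM xq linear0.
rewrite wder_wpoly eqxx ractD ract_scalar (qW i : ract _ _ = _) -scalerDl => /eqP.
rewrite scaler_eq0 (negPf q0) orbF !mxE mulmxnE !mxE !eqxx -addrA addr_eq0.
by rewrite -mulrSr => /eqP.
Qed.

(** Otherwise the i-th coordinate of a weight would be both nonnegative and negative. *)
Lemma wpoly_wder_not_nilpotent i : simple_module P ->
  weight_decomposable (weyl_cartan P) ->
  locally_nilpotent (ract (x i) : rP -> rP) ->
  ~ locally_nilpotent (ract (d i) : rP -> rP).
Proof.
move=> [nzP _] hP xn dn.
have [lam [p [pW p0]]] := @exists_weight_vector F n rP (fun i => ract (x i * d i)) hP nzP.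
have [k kE] := wder_nilpotent_weight dn p0 pW.
have [l lE] := wpoly_nilpotent_weight xn p0 pW.
have : 0 < k%:R + l.+1%:R :> F by rewrite -natrD ltr0n addnS.
by rewrite -kE lE addNr ltxx.
Qed.
End WeylModules.

(** [Q] passes from an entry to every later one, so the entries in [Q] form a suffix. For words of
    operators the suffix acts first. *)
Lemma pairwise_split (T : eqType) (r : rel T) (Q : pred T) (s : seq T) :
  pairwise r s -> {in s &, forall p q, Q p -> r p q -> Q q} ->
  s = filter (predC Q) s ++ filter Q s.
Proof.
elim: s => // p s ih /= /andP[/allP ps s_s] Qr.
have [Qp|nQp] /= := boolP (Q p); last first.
  by rewrite -ih // => a b sa sb; apply: Qr; rewrite inE ?sa ?sb orbT.
have Qs : all Q s.
  by apply/allP => q qs; apply: (Qr p); rewrite ?mem_head ?inE ?qs ?orbT //; exact: ps.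
have /eqP -> : filter (predC Q) s == [::].
  by rewrite -size_eq0 size_filter eqn0Ngt -has_count has_predC Qs.
by rewrite (all_filterP Qs).
Qed.

(** * Straightening of words of operators *)

Section Words.
Variables (F : fieldType) (M : lmodType F) (L : eqType) (rk : L -> nat).
Variable X : L -> {linear M -> M}.
Implicit Types (p q l : L) (w : seq L) (u v : M).
Local Notation sortedw := (pairwise (fun p q => rk p <= rk q)%N).

Definition wact w u : M := foldr (fun p => X p) u w.

Lemma wact_cat w1 w2 u : wact (w1 ++ w2) u = wact w1 (wact w2 u).
Proof. exact: foldr_cat. Qed.

Lemma wact0 w : wact w 0 = 0.
Proof. by elim: w => //= p w ->; rewrite linear0. Qed.

Lemma wact_nseq e p u : wact (nseq e p) u = iter e (X p) u.
Proof. by elim: e => //= e ->. Qed.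

Section Straightening.
Variable v : M.
(** This abstracts the gl(n) case: a bracket of two root vectors is a combination of root vectors
    and of diagonal matrices, and the latter scale weight vectors. Exchanging two letters thus costs
    only shorter words. *)
Hypothesis commX : forall p q w,
  inspan (fun g => g = wact w v \/ exists l, g = X l (wact w v))
    (X p (X q (wact w v)) - X q (X p (wact w v))).

Let Msorted k := inspan (fun g => exists w,
  [/\ sortedw w, (size w <= k)%N & g = wact w v]).

Let Msorted_le k k' u : (k <= k')%N -> Msorted k u -> Msorted k' u.
Proof.
move=> kk'; apply: inspan_sub => g [w [sw wk ->]].
by exists w; split=> //; exact: leq_trans kk'.
Qed.

(** A letter is inserted into a sorted word modulo shorter sorted words. The induction is on a
    length bound, because the error terms are other words of at most that length to which a letter
    is applied again. *)
Let straighten k w p : (size w <= k)%N -> sortedw w ->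
  exists w', [/\ sortedw w', perm_eq w' (p :: w) &
                 Msorted (size w) (X p (wact w v) - wact w' v)].
Proof.
elim: k w p => [|k ih] [|q w] p //= wk.
- by exists [:: p]; split=> //=; rewrite subrr; exact: Inspan0.
- by exists [:: p]; split=> //=; rewrite subrr; exact: Inspan0.
case/andP => qw sw.
have step j l u : (j <= k)%N -> Msorted j u -> Msorted j.+1 (X l u).
  move=> jk; elim=> [|c _ m [y [sy yj ->]] _ ihm]; first by rewrite linear0; exact: Inspan0.
  rewrite linearP; apply: inspanD => //; apply: inspanZ.
  have [y' [sy' y'E yM]] := ih y l (leq_trans yj jk) sy.
  rewrite -[X l _](subrK (wact y' v)); apply: inspanD.
    by apply: Msorted_le yM; exact: leqW.
  by apply: inspan_gen; exists y'; split=> //; rewrite (perm_size y'E).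
have [pq|qp] := leqP (rk p) (rk q).
  exists [:: p, q & w]; split=> //=; last by rewrite subrr; exact: Inspan0.
  rewrite pq qw sw !andbT; apply/allP => l /(allP qw); exact: leq_trans.
have [w' [sw' w'E wM]] := ih w p wk sw.
exists (q :: w'); split.
- rewrite /= sw' andbT (perm_all _ w'E) /= qw andbT; exact: ltnW.
- by rewrite (perm_trans (_ : perm_eq _ (q :: p :: w))) ?perm_cons // (perm_catCA [:: q] [:: p]).
(* The error is the commutator of the letters [p] and [q] on [w], plus [X q] applied to the error of
   inserting [p] into [w]. *)
rewrite -(subrKA (X q (X p (wact w v)))) /= -linearB; apply: inspanD; last exact: step.
apply: inspan_trans (commX p q w) => g [->|[l ->]].
  by apply: inspan_gen; exists w; split.
by apply: step => //; apply: inspan_gen; exists w.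
Qed.

Lemma sorted_words_stable p u :
  inspan (fun g => exists2 w, sortedw w & g = wact w v) u ->
  inspan (fun g => exists2 w, sortedw w & g = wact w v) (X p u).
Proof.
elim=> [|c _ m [w sw ->] _ ih]; first by rewrite linear0; exact: Inspan0.
rewrite linearP; apply: inspanD => //; apply: inspanZ.
have [w' [sw' _ wM]] := straighten p (leqnn _) sw.
rewrite -[X p _](subrK (wact w' v)); apply: inspanD.
  by apply: inspan_sub wM => g [y [sy _ ->]]; exists y.
by apply: inspan_gen; exists w'.
Qed.
End Straightening.

(** With [s] in decreasing rank, its head p acts first, as a block p^e. A nonzero result forces e <
    k, where X_p^k kills v; for each such e, induction at the vector X_p^e v bounds the rest of the
    word. *)
Lemma sorted_nilpotent_bound (s : seq L) v : injective rk ->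
  (forall p, p \in s -> locally_nilpotent (X p)) ->
  exists K, forall w, sortedw w -> {subset w <= s} -> wact w v != 0 -> (size w <= K)%N.
Proof.
move=> rk_inj Xn; pose s' := sort (fun p q => rk q <= rk p)%N s.
suff [K KP] : exists K, forall w, sortedw w -> {subset w <= s'} ->
    wact w v != 0 -> (size w <= K)%N.
  by exists K => w sw ws; apply: KP => // p /ws; rewrite mem_sort.
have {}Xn p : p \in s' -> locally_nilpotent (X p) by rewrite mem_sort; exact: Xn.
have : pairwise (fun p q => rk q <= rk p)%N s'.
  rewrite -sorted_pairwise; last by move=> a b c ab bc; exact: leq_trans bc ab.
  by apply: sort_sorted => a b; exact: leq_total.
elim: {s}s' v Xn => [|p s ih] v Xn.
  by exists 0%N => -[//|q w] _ /(_ q); rewrite mem_head => /(_ isT).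
move=> /= /andP[/allP ps ss].
have [k kE] := Xn p (mem_head _ _) v.
have {}ih e : exists K, forall w, sortedw w -> {subset w <= s} ->
    wact w (iter e (X p) v) != 0 -> (size w <= K)%N.
  by apply: ih => // q qs; apply: Xn; rewrite inE qs orbT.
(* The sum dominates every [K e], and [k] accounts for the block of letters [p]. *)
have [K KP] := choice ih; exists (\sum_(e < k) K e + k)%N => w sw ws.
have wE : w = filter (predC (pred1 p)) w ++ filter (pred1 p) w.
  apply: pairwise_split sw _ => a b _ bw /= /eqP-> pb.
  move: (ws b bw); rewrite inE => /predU1P[->//|/ps bp].
  by apply/eqP/rk_inj/eqP; rewrite eqn_leq bp.
have /all_pred1P fE := filter_all (pred1 p) w.
move: wE; rewrite fE; set w1 := filter (predC _) _; set e := size _ => wE.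
rewrite {1}wE wact_cat wact_nseq => wv.
have ek : (e < k)%N.
  rewrite ltnNge; apply: contraNN wv => ke.
  rewrite -(subnK ke) iterD kE -wact_nseq wact0 wact0 //.
rewrite wE size_cat size_nseq leq_add ?(ltnW ek) //.
apply: leq_trans (_ : K (Ordinal ek) <= _)%N; last by rewrite (bigD1 (Ordinal ek)) //= leq_addr.
apply: KP wv; first by rewrite pairwise_filter.
move=> q; rewrite mem_filter => /= /andP[/negPf qp /ws].
by rewrite inE qp.
Qed.
End Words.

(** * Simple weight modules over gl(n) *)

Section LieEval.
Variables (F : fieldType) (g : lmodType F) (br : g -> g -> g) (V : lieModule br).
(** The action seen as a linear map of the Lie algebra element. *)
Definition lie_eval (v : V) (X : g) : V := lie_act X v.
HB.instance Definition _ v :=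
  GRing.isLinear.Build F g V _ (lie_eval v) (@lie_act_linearl F g br V v).
End LieEval.

Section GlModules.
Variables (F : numFieldType) (n : nat) (V : lieModule (@gl_br F n)).
Local Notation E i j := (lie_act (delta_mx i j : 'M[F]_n) : V -> V).
Local Notation W := (weight_space (gl_cartan V)).
Local Notation "a %:FM" := (map_mx intr a : 'rV[F]_n) (at level 2).

Lemma lie_act0 (v : V) : lie_act 0 v = 0.
Proof. exact: (linear0 (lie_eval v)). Qed.

Lemma gl_delta_comm i j k l (u : V) :
  E i j (E k l u) = E k l (E i j u) + (E i l u *+ (j == k) - E k j u *+ (l == i)).
Proof.
apply/eqP; rewrite addrC -subr_eq; apply/eqP.
rewrite -lie_act_br /gl_br !mul_delta_mx_cond.
rewrite -[LHS]/(lie_eval u _) linearB !linearMn /=.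
by [].
Qed.

Lemma gl_weight_delta lam i j (u : V) :
  W lam u -> W (lam + (Defs.root i j)%:FM) (E i j u).
Proof.
move=> uW k; rewrite /gl_cartan gl_delta_comm [lie_act _ u in X in X + _](uW k).
rewrite linearZ /= /Defs.root map_mxB !map_delta_mx !mxE eqxx /= scalerDl scalerBl.
congr (_ + (_ - _)); rewrite scaler_nat; first by have [->|] := eqVneq k i.
by rewrite eq_sym; have [->|] := eqVneq k j.
Qed.

(** For i != j, E_ij squares to 0, hence (ad E_ij)^3 = 0. Three uses of [iter_commutator] then show
    that any Z moves the kernel of E_ij^k into that of E_ij^(k+3). *)
Lemma gl_injective_or_nilpotent i j : simple_lieModule V -> i != j ->
  injective (E i j) \/ locally_nilpotent (E i j).
Proof.
move=> [_ simpleV] ij; apply: (@injective_or_locally_nilpotent V) => S SE.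
have iL k (c : F) (u v : V) :
    iter k (E i j) (c *: u + v) = c *: iter k (E i j) u + iter k (E i j) v.
  by elim: k => //= k ->; rewrite linearP.
have i0 k : iter k (E i j) 0 = 0 by elim: k => //= k ->; rewrite linear0.
have SP (c : F) (u v : V) : S u -> S v -> S (c *: u + v).
  rewrite SE => -[k kE] [l lE]; exists (k + l)%N.
  by rewrite iL [in iter _ _ v]iterD lE i0 addnC iterD kE i0 scaler0 addr0.
have S0 : S 0 by rewrite SE; exists 0%N.
apply: simpleV => // [u v uS vS|c u uS|Z u].
- by rewrite -[u]scale1r; exact: SP.
- by rewrite -[_ *: _]addr0; exact: SP.
rewrite SE => -[k kE]; exists (k + 3)%N.
have act_br Y m : E i j (lie_act Y m)
    = lie_act Y (E i j m) + lie_act (gl_br (delta_mx i j) Y) m.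
  by rewrite lie_act_br addrC subrK.
do 3![apply: iter_commutator (act_br _) _ k u kE => {}k {}u kE].
suff -> : gl_br (delta_mx i j) (gl_br (delta_mx i j) (gl_br (delta_mx i j) Z)) = 0.
  have /= -> := lie_act0 u; exact: i0.
rewrite /gl_br; have DD : delta_mx i j *m delta_mx i j = 0 :> 'M[F]_n.
  by rewrite mul_delta_mx_0 // eq_sym.
move: (delta_mx i j) DD => D DD.
have DDr (Y : 'M_n) : Y *m D *m D = 0 by rewrite -mulmxA DD mulmx0.
by rewrite !(mulmxBl, mulmxBr, mulmxA) !(DD, DDr, mul0mx, subr0, sub0r, oppr0).
Qed.

Local Notation letter := {p : 'I_n * 'I_n | p.1 != p.2}.
Implicit Types (l : letter) (w : seq letter).

Definition letter_act l : {linear V -> V} := lie_act (delta_mx (val l).1 (val l).2 : 'M[F]_n).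

Definition wdeg w : 'rV[int]_n := \sum_(l <- w) Defs.root (val l).1 (val l).2.

Lemma gl_weight_word lam w (u : V) :
  W lam u -> W (lam + (wdeg w)%:FM) (wact letter_act w u).
Proof.
move=> uW; elim: w => [|l w ih]; first by rewrite /wdeg big_nil map_mx0 addr0.
rewrite /wdeg big_cons raddfD addrCA addrC; exact: gl_weight_delta ih.
Qed.

(** Diagonal matrix units scale the vector of each word, so stability under the root vectors makes
    the span of sorted words a submodule. *)
Lemma simple_gl_span (rk : letter -> nat) lam (v : V) :
  simple_lieModule V -> v != 0 -> W lam v -> forall u : V,
  inspan (fun g => exists2 w, pairwise (fun p q => rk p <= rk q)%N w
                   & g = wact letter_act w v) u.
Proof.
move=> [_ simpleV] v0 vW; set S := inspan _.
have Sl l u : S u -> S (letter_act l u).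
  apply: sorted_words_stable => p q w.
  have uW := gl_weight_word w vW; set y := wact _ w v in uW *.
  rewrite /letter_act /= gl_delta_comm addrC addKr; apply: inspanB.
    have [e|_] := eqVneq; last by exact: Inspan0.
    rewrite mulr1n; have [e'|pq] := eqVneq (val p).1 (val q).2.
      by rewrite -e' [lie_act _ _]uW; apply: inspanZ; apply: inspan_gen; left.
    by apply: inspan_gen; right; exists (exist _ ((val p).1, (val q).2) pq).
  have [e|_] := eqVneq; last by exact: Inspan0.
  rewrite mulr1n; have [e'|pq] := eqVneq (val q).1 (val p).2.
    by rewrite -e' [lie_act _ _]uW; apply: inspanZ; apply: inspan_gen; left.
  by apply: inspan_gen; right; exists (exist _ ((val q).1, (val p).2) pq).
have SE i j u : S u -> S (E i j u).
  have [<-|ij] := eqVneq i j; last exact: (Sl (exist _ (i, j) ij)).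
  elim=> [|c _ m [w sw ->] _ ih]; first by rewrite linear0; exact: Inspan0.
  rewrite linearP /=; apply: inspanD => //; apply: inspanZ.
  rewrite [lie_act _ _](gl_weight_word w vW i); apply: inspanZ; apply: inspan_gen; by exists w.
have Sv : S v by apply: inspan_gen; exists [::].
have [] := simpleV S; [exact: Inspan0 | exact: inspanD | exact: inspanZ | | | ].
- move=> A u Su; have -> : lie_act A u = \sum_i \sum_j A i j *: E i j u.
    rewrite -[LHS]/(lie_eval u A) {1}(matrix_sum_delta A) linear_sum.
    apply: eq_bigr => i _; rewrite linear_sum; apply: eq_bigr => j _.
    exact: (linearZ_LR (lie_eval u)).
  apply: inspan_sum => i _; apply: inspan_sum => j _; apply: inspanZ; exact: SE.
- by move=> S0; move: Sv v0; rewrite S0 => ->; rewrite eqxx.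
- by move=> ST u; have : S u by rewrite ST.
Qed.

(** Every weight of V is that of a sorted word with nonzero action on [v]. Its letters in [S] form
    the suffix [w2], which acts first and nontrivially, so local nilpotence bounds its length. *)
Lemma gl_weight_words (S : pred letter) lam (v : V) :
  simple_lieModule V -> v != 0 -> W lam v ->
  (forall l, S l -> locally_nilpotent (letter_act l)) ->
  exists K : nat, forall mu u, u != 0 -> W mu u -> exists w1 w2,
    [/\ mu = lam + (wdeg (w1 ++ w2))%:FM, all (predC S) w1 & (size w2 <= K)%N].
Proof.
move=> sV v0 vW Sn.
(* The shift by the number of letters ranks [S] above all other letters. *)
pose rk l := (enum_rank l + S l * #|{: letter}|)%N.
have rk_S p q : S p -> (rk p <= rk q)%N -> S q.
  move=> Sp; rewrite /rk Sp mul1n; case: (S q) => //; rewrite mul0n addn0.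
  move/(leq_trans (leq_addl _ _)); rewrite leqNgt.
  by rewrite (leq_trans (ltn_ord (enum_rank q))).
have rk_inj : injective rk.
  move=> p q pq; have Spq : S p = S q by apply/idP/idP => /rk_S; apply; rewrite pq.
  by move: pq; rewrite /rk Spq => /addIn /ord_inj /enum_rank_inj.
have [K KP] := sorted_nilpotent_bound (X := letter_act) (s := enum S) v rk_inj
  (fun p => fun pS => Sn p (etrans (esym (mem_enum S p)) pS)).
exists K => mu u u0 uW.
have Gspan := simple_gl_span rk sV v0 vW u.
have GW g : (exists2 w, pairwise (fun p q => rk p <= rk q)%N w
    & g = wact letter_act w v) -> exists nu, W nu g.
  by move=> [w _ ->]; exists (lam + (wdeg w)%:FM); exact: gl_weight_word.
have [w [sw w0 wW]] : exists w, [/\ pairwise (fun p q => rk p <= rk q)%N w,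
    wact letter_act w v != 0 & W mu (wact letter_act w v)].
  apply: contrapT => now; case/negP: u0; apply/eqP.
  elim: (inspan_weight GW Gspan uW) => // c _ m [[w sw ->] wW] _ ->.
  have [->|w0] := eqVneq (wact letter_act w v) 0; first by rewrite scaler0 addr0.
  by case: now; exists w.
have wE : w = filter (predC S) w ++ filter S w.
  by apply: pairwise_split sw _ => p q _ _; exact: rk_S.
exists (filter (predC S) w), (filter S w); rewrite -wE; split.
- exact: weight_unique w0 wW (gl_weight_word w vW).
- exact: filter_all.
apply: KP; first by rewrite pairwise_filter.
  by move=> l; rewrite mem_filter mem_enum => /andP[].
by apply: contraNneq w0; rewrite {2}wE wact_cat => ->; rewrite wact0.
Qed.
End GlModules.

Lemma int_row_box n (B : nat) : exists s : seq 'rV[int]_n,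
  forall a : 'rV[int]_n, (forall i, `|a 0 i| <= B%:Z) -> a \in s.
Proof.
exists [seq \row_i ((f i : nat)%:Z - B%:Z) | f : {ffun 'I_n -> 'I_(B.*2).+1}].
move=> a aB; have f_lt i : (`|(a 0 i + B%:Z)%R| < (B.*2).+1)%N by have := aB i; lia.
apply/mapP; exists [ffun i => Ordinal (f_lt i)]; first by rewrite mem_enum.
by apply/rowP => i; rewrite !mxE ffunE /=; have := aB i; lia.
Qed.

(** * Bounds on sums of roots *)

Section RootSums.
Variables (n : nat) (sgn : 'I_n -> int).
Local Notation letter := {p : 'I_n * 'I_n | p.1 != p.2}.
Local Notation sgnL l := (sgn (val (l : letter)).1).
Local Notation sgnR l := (sgn (val (l : letter)).2).
Hypothesis sgn_le1 : forall i, `|sgn i| <= 1.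

Definition sgn_letter : pred letter := fun l => (0 <= sgnL l) && (sgnR l <= 0).

Lemma root_coord (i j k : 'I_n) : Defs.root i j 0 k = (k == i)%:R - (k == j)%:R.
Proof. by rewrite !mxE eqxx. Qed.

Lemma sgn_root i j : \sum_k sgn k * Defs.root i j 0 k = sgn i - sgn j.
Proof.
under eq_bigr do rewrite root_coord mulrBr.
rewrite sumrB; congr (_ - _).
  by rewrite (bigD1 i) //= eqxx mulr1 big1 ?addr0 // => k /negPf->; rewrite mulr0.
by rewrite (bigD1 j) //= eqxx mulr1 big1 ?addr0 // => k /negPf->; rewrite mulr0.
Qed.

Lemma sgn_wdeg w : \sum_k sgn k * wdeg w 0 k = \sum_(l <- w) (sgnL l - sgnR l).
Proof.
under eq_bigr do rewrite /wdeg summxE mulr_sumr.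
by rewrite exchange_big; apply: eq_bigr => l _; rewrite sgn_root.
Qed.

(* The letters of [w1] do not increase the linear form given by [sgn], and each
   strict decrease pays for the motion of a coordinate where [sgn] vanishes. *)
Lemma wdeg_bound (w1 w2 : seq letter) (K C : nat) :
  all (predC sgn_letter) w1 -> (size w2 <= K)%N ->
  (forall i, - C%:Z <= sgn i * wdeg (w1 ++ w2) 0 i) ->
  forall i, `|wdeg (w1 ++ w2) 0 i| <= ((3 * K + n * C + C)%N)%:Z.
Proof.
move=> w1S w2K bC i; set b := wdeg _ in bC *.
(* [N] is the total decrease of the linear form along [w1]; a letter of [w2] raises the form by at
   most 2. *)
pose N := \sum_(l <- w1) (sgnR l - sgnL l).
have w2_le (f : letter -> int) (c : nat) : (forall l, f l <= c%:Z) ->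
    \sum_(l <- w2) f l <= (c * K)%N%:Z.
  move=> fc; apply: le_trans (_ : (c * size w2)%N%:Z <= _); last first.
    by rewrite lez_nat leq_mul2l w2K orbT.
  elim: (w2) => [|l w ih]; first by rewrite big_nil muln0.
  by rewrite big_cons /= mulnS PoszD lerD.
have fb : \sum_k sgn k * b 0 k <= (2 * K)%N%:Z - N.
  rewrite sgn_wdeg big_cat /= addrC; apply: lerD.
    by apply: w2_le => -[[j k] /= _]; have := sgn_le1 j; have := sgn_le1 k; lia.
  by rewrite /N -sumrN; apply: ler_sum => l _; rewrite opprB.
have N0 : 0 <= N.
  rewrite /N big_seq; apply: sumr_ge0 => -[[j k] jk] /(allP w1S) /=.
  by rewrite /sgn_letter /=; have := sgn_le1 j; have := sgn_le1 k; lia.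
have sum_ge (Q : pred 'I_n) : - (n * C)%N%:Z <= \sum_(k | Q k) sgn k * b 0 k.
  apply: le_trans (_ : \sum_(k | Q k) - C%:Z <= _); last exact: ler_sum.
  rewrite sumrN lerN2 big_const iter_addr_0 -mulr_natr -[C%:Z]natz -natrM.
  rewrite natz lez_nat mulnC leq_mul2r; apply/orP; right.
  by rewrite -[X in (_ <= X)%N]card_ord max_card.
(* Where [sgn i] is nonzero, the upper bound on the form and the lower bounds on the other terms
   bound the i-th term from above. *)
have [si|si] := eqVneq (sgn i) 0; last first.
  have : sgn i * b 0 i <= (2 * K + n * C)%N%:Z.
    have := sum_ge (fun k => k != i); move: fb; rewrite (bigD1 i) //=.
    set u := \sum_(_ | _) _; move: u (sgn i * _) (N) N0 => u y N' N0; lia.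
  have := bC i; have := sgn_le1 i; move: si.
  by have [->|->|->] : [\/ sgn i = 0, sgn i = 1 | sgn i = -1]; [
     have := sgn_le1 i; case: (sgn i) => [[|[|k]]|[|k]] //; [
       by constructor 1 | by constructor 2 | by constructor 3 ] | | | ]; lia.
have {sum_ge} NC : N <= (2 * K + n * C)%N%:Z by
  move: (sum_ge predT) fb; set u := \sum_(_ | _) _; move: u (N) => u N'; lia.
rewrite /b /wdeg summxE big_cat /=.
(* If a letter of [w1] involves i, where [sgn] is 0, then [sgn] is 1 at its second index or -1 at
   its first; so it contributes 1 to [N]. *)
have w1i : `|\sum_(l <- w1) Defs.root (val l).1 (val l).2 0 i| <= N.
  apply: le_trans (ler_norm_sum _ _ _) _; rewrite /N big_seq [leRHS]big_seq.
  apply: ler_sum => -[[j k] jk] /(allP w1S) /=; rewrite /sgn_letter root_coord /=.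
  have := sgn_le1 j; have := sgn_le1 k; move: jk si => /=.
  by have [<-|_] := eqVneq i j; have [<-|_] := eqVneq i k; rewrite ?eqxx; lia.
have w2i : `|\sum_(l <- w2) Defs.root (val l).1 (val l).2 0 i| <= K%:Z.
  apply: le_trans (ler_norm_sum _ _ _) _; rewrite -[K]mul1n; apply: w2_le => l.
  by rewrite root_coord; case: (_ == _); case: (_ == _).
apply: le_trans (ler_normD _ _) (le_trans (lerD w1i w2i) _).
by move: (N) NC => N' NC; lia.
Qed.
End RootSums.

(** * Weight multiplicities of the tensor module *)

Section TensorModules.
Variables (F : numFieldType) (n : nat).
Variables (P : lmodType (weyl F n)) (V : lieModule (@gl_br F n)).
Local Notation x i := (wpoly ('X_i : {mpoly F[n]})).
Local Notation d i := (wder F (i : 'I_n)).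
Local Notation rP := (Defs.restrict P).
Local Notation T := (tensor_module P V).
Local Notation E i j := (lie_act (delta_mx i j : 'M[F]_n) : V -> V).
Local Notation WP := (weight_space (weyl_cartan P)).
Local Notation WV := (weight_space (gl_cartan V)).
Local Notation WT := (weight_space (witt_cartan T)).
Local Notation "a %:FM" := (map_mx intr a : 'rV[F]_n) (at level 2).
Local Notation hP := (fun i => ract (x i * d i) : {linear rP -> rP}).
Local Notation hT :=
  (fun i => lie_act (wvf ('X_i : {mpoly F[n]}) i) : {linear T -> T}).

Lemma tensor_cartan i (p : rP) (v : V) : witt_cartan T i (tens p v : T)
  = tens (weyl_cartan P i p) v + tens p (gl_cartan V i v).
Proof.
rewrite /witt_cartan /= tensor_module_vf; congr (_ + _).
rewrite (bigD1 i) //= big1 ?addr0 => [|j ji].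
  by rewrite mderivX_ord eqxx /= (_ : ract _ _ = p) //; apply: etrans (scale1r (p : P));
    congr (_ *: _); apply: weylP; apply: endoP => f /=; rewrite mul1r.
by rewrite mderivX_ord eq_sym (negPf ji) linear0 /ract scale0r tens0l.
Qed.

Lemma tensor_weight lam mu (p : rP) (v : V) :
  WP lam p -> WV mu v -> WT (lam + mu) (tens p v : T).
Proof.
move=> pW vW i; rewrite tensor_cartan pW vW mxE scalerDl; congr (_ + _).
  by have := tens_linearl v (lam 0 i) p 0; rewrite addr0 tens0l addr0.
exact: linearZ.
Qed.

Lemma inspan_tens (G : rP -> Prop) (H : V -> Prop) :
  (forall p, inspan G p) -> (forall v, inspan H v) -> forall t : tensor rP V,
  inspan (fun g => exists p v, [/\ G p, H v & g = tens p v]) t.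
Proof.
move=> Gs Hs; apply: tens_ind => [|p v t ih]; first exact: Inspan0.
apply: inspanD ih; elim: (Gs p) => [|c q u Gq _ ih].
  by rewrite tens0l; exact: Inspan0.
rewrite tens_linearl; apply: inspanD ih; apply: inspanZ.
by apply: inspan_linear (Hs v) => w Hw; apply: inspan_gen; exists q, w.
Qed.

(** As the weight space of [lam] is the line through [p], P is the direct sum of that line and the
    span [K] of the other weight spaces; [c] reads off the coefficient of [p]. It detects
    independence in the tensor product. *)
Lemma weight_functional lam (p : rP) : simple_module P ->
  weight_decomposable (weyl_cartan P) -> p != 0 -> WP lam p ->
  exists c : rP -> F, [/\ scalar c, c p = 1 &
    forall mu q, mu != lam -> WP mu q -> c q = 0].
Proof.
move=> sP hdP p0 pW; pose K := inspan (fun g : rP => exists2 mu, mu != lam & WP mu g).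
have K0 (e : F) : K (e *: p) -> e = 0.
  move=> Ke; have eW : WP lam (e *: p) := @weight_spaceZ F n rP hP lam e p pW.
  have GW (g : rP) : (exists2 mu, mu != lam & WP mu g) -> exists mu, WP mu g.
    by move=> [mu _ gW]; exists mu.
  apply/eqP; have : e *: p = 0.
    elim: (@inspan_weight F n rP hP _ _ _ GW Ke eW) => // c g v [[mu mu_lam gW] gW'] _ ->.
    have [->|g0] := eqVneq g 0; first by rewrite scaler0 addr0.
    by rewrite (@weight_unique F n rP hP _ _ _ g0 gW gW') eqxx in mu_lam.
  by move/eqP; rewrite scaler_eq0 (negPf p0) orbF.
have /choice[c cK] : forall u : rP, exists e : F, K (u - e *: p).
  move=> u; elim: (@weight_decomposable_span F n rP hP hdP u) => [|a g v [mu gW] _ [e eK]].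
    by exists 0; rewrite scale0r subr0; exact: Inspan0.
  have [mu_lam|mu_lam] := eqVneq mu lam; last first.
    by exists e; rewrite -addrA; apply: InspanP => //; exists mu.
  rewrite mu_lam in gW; have [b ->] := simple_weyl_weight_line sP p0 pW gW.
  by exists (a * b + e); rewrite scalerDl scalerA opprD addrACA subrr add0r.
have cE u e : K (u - e *: p) -> c u = e.
  move=> uK; apply/eqP; rewrite -subr_eq0; apply/eqP/K0; rewrite scalerBl.
  have -> : c u *: p - e *: p = (u - e *: p) - (u - c u *: p).
    by rewrite opprB [RHS]addrC addrA subrK.
  apply: inspanB; [exact: uK | exact: cK].
exists c; split=> [a u v||mu q mu_lam qW]; apply: cE.
- have -> : a *: u + v - (a * c u + c v) *: p = a *: (u - c u *: p) + (v - c v *: p).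
    by rewrite scalerDl scalerBr scalerA opprD addrACA.
  by apply: inspanD; [apply: inspanZ; exact: cK | exact: cK].
- by rewrite scale1r subrr; exact: Inspan0.
- by rewrite scale0r subr0; apply: inspan_gen; exists mu.
Qed.

Lemma tensor_infinite i j : simple_module P ->
  weight_decomposable (weyl_cartan P) -> simple_lieModule V ->
  weight_decomposable (gl_cartan V) ->
  injective (ract (x i) : rP -> rP) -> injective (ract (d j) : rP -> rP) ->
  injective (E j i) -> i != j -> ~ finite_multiplicities (witt_cartan T).
Proof.
move=> sP hdP sV hdV xi dj Eji ij finT.
have [mu [p0 [p0W p00]]] := @exists_weight_vector F n rP hP hdP sP.1.
have [nu [v0 [v0W v00]]] :=
  @exists_weight_vector F n V (fun i => lie_act (delta_mx i i)) hdV sV.1.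
pose p k : rP := iter k (fun q : rP => ract (x i) (ract (d j) q)) p0.
pose v k : V := iter k (E j i) v0.
have pW k : WP (mu + (Defs.root i j *+ k)%:FM) (p k).
  elim: k => [|k ih]; first by rewrite mulr0n map_mx0 addr0.
  have := weyl_weight_wpoly i (weyl_weight_wder j ih).
  congr (WP _ _); rewrite mulrS raddfD /= map_mxB !map_delta_mx -!addrA.
  by congr (mu + _); rewrite [RHS]addrC -addrA [LHS]addrCA.
have vW k : WV (nu - (Defs.root i j *+ k)%:FM) (v k).
  elim: k => [|k ih]; first by rewrite mulr0n map_mx0 subr0.
  have := gl_weight_delta j i ih; congr (WV _ _).
  have -> : Defs.root j i = - Defs.root i j by rewrite opprB.
  by rewrite map_mxN mulrSr [map_mx _ (_ *+ _ + _)]map_mxD opprD addrA.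
have v_neq0 k : v k != 0.
  elim: k => //= k; apply: contra => /eqP vk; apply/eqP/Eji.
  by rewrite vk linear0.
have p_neq0 k : p k != 0.
  elim: k => //= k; apply: contra => /eqP pk; apply/eqP/dj/xi.
  by rewrite pk !linear0.
have tW k : WT (mu + nu) (tens (p k) (v k) : T).
  by have := tensor_weight (pW k) (vW k); rewrite addrACA subrr addr0.
have [m [e [[k ek]]]] := finite_dim_dependent (finT (mu + nu)) tW.
(* The vectors [p l] have distinct weights, so [c] tensored with the identity of V turns the
   relation into [e k *: v k = 0]. *)
have [c [cl cp c0]] := weight_functional sP hdP (p_neq0 k) (pW k).
have fl (u : V) : linear (fun q : rP => c q *: u).
  by move=> a q r; rewrite cl scalerDl scalerA.
have fr (q : rP) : linear (fun u : V => c q *: u).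
  by move=> a u w; rewrite scalerDr !scalerA mulrC.
have [phi phiE] : exists phi : {linear tensor rP V -> V},
    forall q u, phi (tens q u) = c q *: u.
  pose phi : {linear tensor rP V -> V} := HB.pack (tlift (fun (q : rP) (u : V) => c q *: u))
    (GRing.isLinear.Build F (tensor rP V) V _ _ (tlift_linear fl fr)).
  by exists phi => q u; exact: (tliftE fl fr).
move=> /(congr1 phi); rewrite linear0 linear_sum (bigD1 k) //= big1 => [|l lk].
  rewrite addr0 linearZ_LR phiE cp scale1r => /eqP.
  by rewrite scaler_eq0 (negPf ek) (negPf (v_neq0 k)).
rewrite linearZ_LR phiE (c0 _ _ _ (pW l)) ?scale0r ?scaler0 //.
apply: contra lk => /eqP/addrI/map_intr_inj/rowP/(_ i).
by rewrite !mulmxnE !mxE !eqxx (negPf ij) subr0 -val_eqE /= => /eqP; rewrite eqr_nat.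
Qed.

Lemma tensor_finite : simple_module P ->
  weight_decomposable (weyl_cartan P) -> simple_lieModule V ->
  weight_decomposable (gl_cartan V) -> finite_multiplicities (gl_cartan V) ->
  (forall i j, i != j -> injective (ract (x i) : rP -> rP) ->
     injective (ract (d j) : rP -> rP) -> locally_nilpotent (E j i)) ->
  finite_multiplicities (witt_cartan T).
Proof.
move=> sP hdP sV hdV finV nilV lam.
have [mu [p0 [p0W p00]]] := @exists_weight_vector F n rP hP hdP sP.1.
have [nu [v0 [v0W v00]]] :=
  @exists_weight_vector F n V (fun i => lie_act (delta_mx i i)) hdV sV.1.
pose dn i := `[< locally_nilpotent (ract (d i) : rP -> rP) >].
pose xn i := `[< locally_nilpotent (ract (x i) : rP -> rP) >].
pose sgn i : int := if dn i then -1 else if xn i then 1 else 0.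
have sgn1 i : `|sgn i| <= 1 by rewrite /sgn; case: (dn i); case: (xn i).
(* Nonnegative sign at the first index makes d injective there, and nonpositive sign at the second
   makes x injective there. *)
have Sn l : sgn_letter sgn l -> locally_nilpotent (letter_act V l).
  case/andP => l1 l2; apply: nilV; first by rewrite eq_sym (valP l).
    have [//|xl] := wpoly_injective_or_nilpotent (val l).2 sP.
    move: l2; rewrite /sgn /dn /xn; case: asboolP => [dl _|_].
      by case: (wpoly_wder_not_nilpotent sP hdP xl dl).
    by case: asboolP.
  have [//|dl] := wder_injective_or_nilpotent (val l).1 sP.
  by move: l1; rewrite /sgn /dn asboolT.
have [K KP] := gl_weight_words sV v00 v0W Sn.
pose q a : rP := ract (wmono F a) p0.
have qW a : WP (mu + a%:FM) (q a) by exact: weyl_weight_wmono.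
(* [A] selects the exponents that contribute to the weight space of [lam]. *)
pose A a := q a != 0 /\ exists2 u : V, u != 0 & WV (lam - mu - a%:FM) u.
(* Nilpotence of d_i keeps mu_i + a_i nonnegative and that of x_i keeps it negative, which bounds
   a_i on one side. *)
have /choice[c cP] : forall i, exists c : nat, forall a, A a -> sgn i * a 0 i <= c%:Z.
  move=> i; rewrite /sgn /dn /xn; case: asboolP => [dl|_]; last case: asboolP => [xl|_].
  - have [m mE] := wder_nilpotent_weight dl p00 p0W; exists m => a [qa _].
    have [k] := wder_nilpotent_weight dl qa (qW a).
    by rewrite !mxE mE !pmulrn -intrD => /eqP; rewrite eqr_int => /eqP; lia.
  - have [m mE] := wpoly_nilpotent_weight xl p00 p0W; exists m => a [qa _].
    have [k] := wpoly_nilpotent_weight xl qa (qW a).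
    by rewrite !mxE mE !pmulrn -!mulrNz -intrD => /eqP; rewrite eqr_int => /eqP; lia.
  - by exists 0%N => a _; rewrite mul0r.
have [B AB] : exists B : nat, forall a, A a -> forall i, `|a 0 i| <= B%:Z.
  have [[a0 Aa0]|noA] := pselect (exists a, A a); last first.
    by exists 0%N => a Aa; case: noA; exists a.
  have Aw a : A a -> exists w1 w2, [/\ lam - mu - nu = (a + wdeg (w1 ++ w2))%:FM,
      all (predC (sgn_letter sgn)) w1 & (size w2 <= K)%N].
    move=> [_ [u u0 /(KP _ _ u0)[w1 [w2 [wE w1S w2K]]]]]; exists w1, w2; split=> //.
    by rewrite raddfD /= -[_ - nu](subrK a%:FM) addrC; congr (_ + _);
      rewrite addrAC wE addrC addKr.
  (* One contributing exponent shows that lam - mu - nu is an integral row [kap]; each other one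
     then satisfies a = kap - wdeg. *)
  have [w1 [w2 [kE _ _]]] := Aw _ Aa0; move: (a0 + _) kE => kap kE {w1 w2}.
  pose C := (\sum_i (`|kap 0%R i| + c i))%N.
  have Cge i : (`|kap 0%R i| + c i <= C)%N by rewrite /C (bigD1 i) //= leq_addr.
  (* The last [C] bounds the coordinate of [kap]; the other terms are the bound on [wdeg]. *)
  exists (3 * K + n * C + C + C)%N => a Aa i.
  have [w1 [w2 [kE' w1S w2K]]] := Aw _ Aa.
  have {kE'} kE' : kap = a + wdeg (w1 ++ w2).
    by apply: (@map_intr_inj F); rewrite -kE -kE'.
  have wC k : - C%:Z <= sgn k * wdeg (w1 ++ w2) 0 k.
    have := congr1 (fun r : 'rV_n => r 0 k) kE'; rewrite mxE => {}kE'.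
    have := cP k a Aa; have := Cge k.
    have : sgn k * kap 0 k = sgn k * a 0 k + sgn k * wdeg (w1 ++ w2) 0 k.
      by rewrite kE' mulrDr.
    have : `|sgn k * kap 0 k| <= `|kap 0 k| by rewrite normrM ler_piMl.
    by lia.
  have tri (y z w : int) (m1 m2 m3 : nat) :
      y = z + w -> (`|y| + m1 <= m2)%N -> `|w| <= m3%:Z -> `|z| <= (m3 + m2)%N%:Z.
    by lia.
  have := congr1 (fun r : 'rV_n => r 0 i) kE'; rewrite mxE => {}kE'.
  exact: tri kE' (Cge i) (wdeg_bound sgn1 w1S w2K wC i).
have [s sP'] := int_row_box n B.
have /choice[b bP] : forall a, exists r : seq V,
    (forall m, m \in r -> WV (lam - mu - a%:FM) m) /\
    forall m, WV (lam - mu - a%:FM) m -> inspan (fun g => g \in r) m.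
  by move=> a; apply: finite_dim_seq; exact: finV.
apply: (@finite_dim_inspan F T _ [seq tens (q a) u | a <- s, u <- b a]).
  move=> _ /allpairsPdep[a [u [_ ub ->]]].
  by have := tensor_weight (qW a) ((bP a).1 _ ub); rewrite addrC -[_ - _ - _]addrA -opprD subrK.
move=> t tW.
have Tspan := inspan_tens (simple_weyl_span sP p00 p0W)
  (@weight_decomposable_span F n V (fun i => lie_act (delta_mx i i)) hdV) t.
have GW (g : T) : (exists (p : rP) (u : V), [/\ exists a, p = q a, exists la, WV la u
    & g = tens p u]) -> exists la, WT la g.
  move=> [_ [u [[a ->] [la uW] ->]]]; exists (mu + a%:FM + la).
  exact: tensor_weight.
apply: inspan_trans (@inspan_weight F n T hT _ _ _ GW Tspan tW).
move=> _ [[_ [u [[a ->] [la uW] ->]]] gW].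
have [->|g0] := eqVneq (tens (q a) u) 0; first exact: Inspan0.
have laE : la = lam - mu - a%:FM.
  have := @weight_unique F n T hT _ _ _ g0 gW (tensor_weight (qW a) uW).
  by move=> ->; rewrite -[RHS]addrA -opprD addrC addKr.
rewrite laE in uW; have as_ : a \in s.
  apply/sP'/AB; split; first by apply: contraNneq g0 => ->; rewrite tens0l.
  by exists u => //; apply: contraNneq g0 => ->; rewrite linear0.
apply: inspan_linear ((bP a).2 _ uW) => w wb; apply: inspan_gen.
by apply/allpairsPdep; exists a, w.
Qed.
End TensorModules.

(** * Translation into shadows *)

Section Shadows.
Local Open Scope classical_set_scope.
Variables (F : numFieldType) (n : nat).
Variables (P : lmodType (weyl F n)) (V : lieModule (@gl_br F n)).
Local Notation x i := (wpoly ('X_i : {mpoly F[n]})).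
Local Notation d i := (wder F (i : 'I_n)).
Local Notation rP := (Defs.restrict P).
Local Notation E i j := (lie_act (delta_mx i j : 'M[F]_n) : V -> V).

Lemma root_inj (i j k l : 'I_n) : i != j ->
  Defs.root i j = Defs.root k l -> i = k /\ j = l.
Proof.
move=> ij /rowP e; have := e i; have := e j; rewrite !root_coord !eqxx.
rewrite (negPf ij) eq_sym (negPf ij).
by have [->|_] := eqVneq j l; have [->|_] := eqVneq i k;
  case: (j == k); case: (i == l).
Qed.

Lemma rootN (i j : 'I_n) : - Defs.root i j = Defs.root j i.
Proof. exact: opprB. Qed.

(** With E_ji locally nilpotent, the dichotomy for E_ij decides between the two sets: nilpotent
    gives F, injective gives the minus part. *)
Lemma shadow_gl_root i j : simple_lieModule V -> i != j ->
  (DeltaF_gl V `|` Deltam_gl V) (Defs.root i j) <-> locally_nilpotent (E j i).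
Proof.
move=> sV ij; split=> [|En].
  case=> [[k [l [kl /(root_inj ij)[-> ->] [_ //]]]]|].
  move=> [_ [k [l [kl -> [En _]]]]]; rewrite rootN => e.
  by have [-> ->] := root_inj ij (esym e).
have [Ei|En'] := gl_injective_or_nilpotent sV ij; last by left; exists i, j.
by right; exists (Defs.root j i); [exists j, i; rewrite eq_sym | rewrite rootN].
Qed.

(** The right side says that i is not in I^- and j is not in I^+. If i is in I^+ or j is in I^-,
    this is a root of the minus part; otherwise both indices lie in I^0. *)
Lemma shadow_weyl_root i j : simple_module P ->
  weight_decomposable (weyl_cartan P) -> i != j ->
  (DeltaI_weyl P `|` Deltam_weyl P) (Defs.root i j) <->
  injective (ract (x i) : rP -> rP) /\ injective (ract (d j) : rP -> rP).
Proof.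
move=> sP hdP ij; have xdn k := @wpoly_wder_not_nilpotent F n P k sP hdP.
have xin k := @wpoly_injective_or_nilpotent F n P k sP.
have din k := @wder_injective_or_nilpotent F n P k sP.
have d_plus k : locally_nilpotent (ract (d k) : rP -> rP) -> Iplus P k.
  by move=> dn; split=> //; case: (xin k) => // /xdn.
have x_minus k : locally_nilpotent (ract (x k) : rP -> rP) -> Iminus P k.
  by move=> xn; split=> //; case: (din k) => // dn; case: (xdn k).
split.
  case=> -[k [l [kl /(root_inj ij)[<- <-]]]]; first by move=> [[? _] [_ ?]].
  case=> [[[_ ?] nj]|[ni [_ ?]]]; split=> //.
    by case: (din j) => // /d_plus.
  by case: (xin i) => // /x_minus.
move=> [xi dj]; have [di|di] := din i; last first.
  right; exists i, j; split=> //; left; split; first exact: d_plus.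
  (* On a nonzero module no operator is both injective and locally nilpotent. *)
  move=> [dn _]; have [p p0] := sP.1.
  have [k [q0 dq]] := @locally_nilpotent_last rP (ract (d j)) p dn p0.
  by case/negP: q0; apply/eqP/dj; rewrite dq linear0.
have [xj|xj] := xin j; first by left; exists i, j.
right; exists i, j; split=> //; right; split; last exact: x_minus.
move=> [xn _]; have [p p0] := sP.1.
have [k [q0 xq]] := @locally_nilpotent_last rP (ract (x i)) p xn p0.
by case/negP: q0; apply/eqP/xi; rewrite xq linear0.
Qed.

Lemma tensor_finite_multiplicities_shadows :
  simple_module P -> weight_decomposable (weyl_cartan P) ->
  simple_lieModule V -> weight_decomposable (gl_cartan V) ->
  finite_multiplicities (gl_cartan V) ->
  (finite_multiplicities (witt_cartan (tensor_module P V)) <->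
   DeltaI_weyl P `|` Deltam_weyl P `<=` DeltaF_gl V `|` Deltam_gl V).
Proof.
move=> sP hdP sV hdV finV; split=> [finT a Da|sub].
  have [i [j [ij aE]]] : exists i j, i != j /\ a = Defs.root i j.
    by case: Da => -[i [j [ij aE _]]]; exists i, j.
  rewrite {}aE in Da *; have [xi dj] := (shadow_weyl_root sP hdP ij).1 Da.
  apply/(shadow_gl_root sV ij); rewrite eq_sym in ij.
  have [Ei|//] := gl_injective_or_nilpotent sV ij; rewrite eq_sym in ij.
  by case: (tensor_infinite sP hdP sV hdV xi dj Ei ij).
apply: tensor_finite => // i j ij xi dj.
by apply/(shadow_gl_root sV ij)/sub/(shadow_weyl_root sP hdP ij).
Qed.
End Shadows.

Local Open Scope classical_set_scope.

Theorem theorem3p5 (R : realType) (n : nat)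
    (P : lmodType (weyl R[i] n)) (V : lieModule (@gl_br R[i] n)) :
  simple_module P ->
  weight_decomposable (weyl_cartan P) ->
  simple_lieModule V ->
  weight_decomposable (gl_cartan V) ->
  finite_multiplicities (gl_cartan V) ->
  (finite_multiplicities (witt_cartan (tensor_module P V)) <->
   DeltaI_weyl P `|` Deltam_weyl P `<=` DeltaF_gl V `|` Deltam_gl V).
Proof. exact: tensor_finite_multiplicities_shadows. Qed.
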